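(* Let $\Phi_1=\{q^2: q\equiv 1 \pmod 4 \text{ is a prime power}\}$, $\Phi_2=\{n^4: n\in\mathbb N,\ n\equiv 1\pmod 2\}\cup\{9n^4: n\in\mathbb N,\ n\equiv 1\pmod 2\}$, $\Phi_3=\{5\}$ and $\Phi_4=\{13,37\}$. Then the following hold: (1) There exists a Hadamard matrix of order $4(2v+1)$ for every $v\in\Phi_1\cup\Phi_2\cup\Phi_3\cup\Phi_4$. (2) There exists a Hadamard matrix of order $4(3v+1)$ for every $v\in\Phi_1\cup\Phi_2\cup\Phi_3$. (3) There exists a Hadamard matrix of order $4(5v+1)$ for every $v\in\Phi_1\cup\Phi_2\cup\Phi_3$. (4) There exists a Hadamard matrix of order $8(uv+1)$ for every $u\in\Phi_1\cup\Phi_2$ and every $v\in\Phi_1\cup\Phi_2\cup\Phi_3$.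
   Context: A Hadamard matrix of order $m$ is an $m\times m$ matrix $M$ with all entries in $\{-1,1\}$ such that $MM^{\mathrm T}=mI$. *)

(* Defs.v *)
From mathcomp Require Import all_boot all_order all_algebra.

Set Implicit Arguments.
Unset Strict Implicit.
Unset Printing Implicit Defensive.

Import GRing.Theory.

Definition hadamard_matrix (m : nat) (M : 'M[int]_m) : Prop :=
  (forall i j, M i j = 1%R \/ M i j = (-1)%R) /\
  (M *m M^T = (m%:R)%:M)%R.

Definition prime_power (q : nat) : Prop :=
  exists p k : nat, [/\ prime p, 0 < k & q = p ^ k].

Definition Phi1 (v : nat) : Prop :=
  exists q : nat, [/\ prime_power q, q = 1 %[mod 4] & v = q ^ 2].

Definition Phi2 (v : nat) : Prop :=
  exists n : nat, n = 1 %[mod 2] /\ (v = n ^ 4 \/ v = 9 * n ^ 4).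

Definition Phi3 (v : nat) : Prop := v = 5.

Definition Phi4 (v : nat) : Prop := v = 13 \/ v = 37.

(* Main.v *)
Require Import Defs.
From HB Require Import structures.
From mathcomp Require Import all_boot all_order all_algebra all_field ring zify.

(* Work in the group ring Z[G] of an abelian group G of order v, with J the sum of all elements.
   For v in Phi_1 or Phi_2 there are symmetric {0, 1, -1}-valued elements P, R, H, K with
   P^2 + R^2 = v + J, P R = J and H^2 + K^2 = v - J, such that P +- H and R +- K are +-1 valued,
   and a symmetric c with c^2 = v - J whose values off 0 are +-1.
   - For v = q^2, G is the plane F_q^2: P and R are signed sums of lines, H and K are the real and
     imaginary parts of a quartic character of F_(q^2), and c is its quadratic character.
   - For v = q^4, P and R are signed sums of lines of the plane over F_(q^2), and H + K, H - K are
     extensions of eigenvectors of the Paley conference matrix on the projective line over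
     F_(q^2) for the eigenvalues q and -q.  Exactly one of P +- H, R +- K is then nonzero at each
     nontrivial character, which is preserved by a composition of Turyn; this gives n^4, and
     9 n^4 after adding the plane over F_3.
   Arranging P +- H, R +- K and c +- 1 in sequences over the cyclic groups of order 2, 3 and 5 gives
   four elements whose autocorrelations sum to 4 (w v + 1) - 4 J, and a bordered Goethals-Seidel
   array of order 4 (w v + 1).  For 8 (u v + 1), two quadruples give four elements D with
   sum of squares 4 (u v - J), and the eight elements D +- 1 fit in a bordered orthogonal design
   of octonion type.  The sporadic orders are Paley or Sylvester matrices, and
   8 (5 u + 1) = 2 * 4 (5 u + 1). *)

Set Implicit Arguments.
Unset Strict Implicit.
Unset Printing Implicit Defensive.

Import Order.TTheory GRing.Theory Num.Theory.

Local Open Scope ring_scope.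

(** * Integral group rings of finite abelian groups *)

HB.instance Definition _ (G H : finZmodType) := Finite.on (G * H)%type.

Definition galg (G : finZmodType) := {ffun G -> int}.

HB.instance Definition _ (G : finZmodType) := GRing.Zmodule.on (galg G).

Section GroupAlgebra.
Variable G : finZmodType.
Implicit Types f g h : galg G.

Definition gdelta (a : G) : galg G := [ffun x => (x == a)%:Z].

Definition gconv f g : galg G := [ffun x => \sum_y f y * g (x - y)].

Lemma gconvC : commutative gconv.
Proof.
move=> f g; apply/ffunP=> x; rewrite !ffunE.
rewrite (reindex_inj (inv_inj (subKr x))) /=.
by apply: eq_bigr => y _; rewrite subKr mulrC.
Qed.

Lemma gconvA : associative gconv.
Proof.
move=> f g h; apply/ffunP=> x; rewrite !ffunE.
under [RHS]eq_bigr => w _ do rewrite ffunE big_distrl /=.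
rewrite [RHS]exchange_big /=; apply: eq_bigr => y _.
rewrite ffunE big_distrr /= [RHS](reindex_inj (addIr y)) /=.
by apply: eq_bigr => z _; rewrite mulrA addrK opprD addrA addrAC.
Qed.

Lemma gconv1l : left_id (gdelta 0) gconv.
Proof.
move=> f; apply/ffunP=> x; rewrite ffunE (bigD1 0) //= big1 => [|y /negPf y0].
  by rewrite ffunE eqxx mul1r addr0 subr0.
by rewrite ffunE y0 mul0r.
Qed.

Lemma gconvDl : left_distributive gconv +%R.
Proof.
move=> f g h; apply/ffunP=> x; rewrite !ffunE -big_split /=.
by apply: eq_bigr => y _; rewrite ffunE mulrDl.
Qed.

Lemma gdelta_neq0 : gdelta 0 != 0.
Proof. by apply/eqP=> /ffunP/(_ 0); rewrite !ffunE eqxx. Qed.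

HB.instance Definition _ := GRing.Zmodule_isComNzRing.Build (galg G)
  gconvA gconvC gconv1l gconvDl gdelta_neq0.

Lemma gmulE f g x : (f * g) x = \sum_y f y * g (x - y).
Proof. by rewrite [LHS]ffunE. Qed.

Lemma gaddE f g x : (f + g) x = f x + g x.
Proof. by rewrite [LHS]ffunE. Qed.

Lemma goppE f x : (- f) x = - f x.
Proof. by rewrite [LHS]ffunE. Qed.

Lemma gzeroE x : (0 : galg G) x = 0.
Proof. by rewrite [LHS]ffunE. Qed.

Lemma goneE x : (1 : galg G) x = (x == 0)%:Z.
Proof. by rewrite [LHS]ffunE. Qed.

Lemma gmulrnE f n x : (f *+ n) x = f x *+ n.
Proof. by elim: n => [|n IH]; rewrite ?mulr0n ?gzeroE // !mulrS gaddE IH. Qed.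

Lemma gsumE (I : Type) (r : seq I) (P : pred I) (F : I -> galg G) x :
  (\sum_(i <- r | P i) F i) x = \sum_(i <- r | P i) F i x.
Proof.
by elim/big_rec2: _ => [|i a b _ <-]; rewrite ?gzeroE ?gaddE.
Qed.

Lemma gnatE n x : (n%:R : galg G) x = n%:Z * (x == 0)%:Z.
Proof. by rewrite gmulrnE goneE -mulr_natl; congr (_ * _); rewrite natz. Qed.

Definition gE := (gaddE, goppE, gzeroE, goneE, gnatE, gmulrnE).

Lemma galgP f g : (forall x, f x = g x) <-> f = g.
Proof. by split=> [/ffunP|->]. Qed.

(** Z[G] is torsion free, so identities may be proved after multiplying by 2, by 4 or by the order
    of a field. *)
Lemma gmulrnI n f g : (0 < n)%N -> f *+ n = g *+ n -> f = g.
Proof.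
move=> n0 e; apply/galgP => x; move/galgP/(_ x): e; rewrite !gmulrnE => /eqP.
by rewrite eqrMn2r // => /orP[|/eqP//]; case: n n0.
Qed.

(** The sum J of all group elements; the unit of the ring is [gdelta 0]. *)
Definition gone : galg G := [ffun => 1].

Lemma goneallE x : gone x = 1. Proof. by rewrite ffunE. Qed.

Lemma mul_goneE f x : (gone * f) x = \sum_y f y.
Proof. by rewrite mulrC gmulE; apply: eq_bigr => y _; rewrite goneallE mulr1. Qed.

Definition geven f := forall x, f (- x) = f x.

Lemma gevenD f g : geven f -> geven g -> geven (f + g).
Proof. by move=> ef eg x; rewrite !gE ef eg. Qed.

Lemma gevenN f : geven f -> geven (- f).
Proof. by move=> ef x; rewrite !gE ef. Qed.

Lemma geven1 : geven 1.
Proof. by move=> x; rewrite !gE oppr_eq0. Qed.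

Lemma gevenM f g : geven f -> geven g -> geven (f * g).
Proof.
move=> ef eg x; rewrite !gmulE (reindex_inj oppr_inj) /=.
by apply: eq_bigr => y _; rewrite ef -opprD eg.
Qed.

(** The involution inverting group elements; [f * gstar f] collects the autocorrelations of f. *)
Definition gstar f : galg G := [ffun x => f (- x)].

Lemma gstar_even f : geven f -> gstar f = f.
Proof. by move=> ef; apply/galgP=> x; rewrite ffunE ef. Qed.

Lemma gstarD f g : gstar (f + g) = gstar f + gstar g.
Proof. by apply/galgP=> x; rewrite !ffunE. Qed.

Lemma gstarN f : gstar (- f) = - gstar f.
Proof. by apply/galgP=> x; rewrite !ffunE. Qed.

Lemma gstarM f g : gstar (f * g) = gstar f * gstar g.
Proof.
apply/galgP=> x; rewrite ffunE !gmulE (reindex_inj oppr_inj) /=.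
by apply: eq_bigr => y _; rewrite !ffunE opprB opprK addrC.
Qed.

Lemma gdeltaD a b : gdelta a * gdelta b = gdelta (a + b).
Proof.
apply/galgP=> x; rewrite gmulE (bigD1 a) //= big1 => [|y /negPf ya].
  by rewrite !ffunE eqxx mul1r addr0 subr_eq addrC.
by rewrite ffunE ya mul0r.
Qed.

Lemma gstar_delta a : gstar (gdelta a) = gdelta (- a).
Proof. by apply/galgP=> x; rewrite !ffunE eqr_oppLR. Qed.

End GroupAlgebra.
Arguments gone {G}.

(** * Group rings of product groups *)

Section Tensor.
Variables G1 G2 : finZmodType.
Local Notation G := (G1 * G2)%type.

(** With these two embeddings [ginl f * ginr g] is the tensor product of f and g. *)
Definition ginl (f : galg G1) : galg G := [ffun x => f x.1 * (x.2 == 0)%:Z].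
Definition ginr (f : galg G2) : galg G := [ffun x => f x.2 * (x.1 == 0)%:Z].

Lemma ginlrE (f : galg G1) (g : galg G2) x : (ginl f * ginr g) x = f x.1 * g x.2.
Proof.
rewrite gmulE (bigD1 (x.1, 0)) //= big1 ?addr0 => [|[a b] /= ab].
  by rewrite !ffunE /= eqxx subr0 subrr eqxx !mulr1.
rewrite !ffunE /=; case: (b =P 0) => [b0|_]; last by rewrite mulr0 mul0r.
rewrite b0 xpair_eqE eqxx andbT in ab.
by rewrite subr_eq0 eq_sym (negPf ab) !mulr0.
Qed.

Fact ginl_zmod : zmod_morphism ginl.
Proof. by move=> f g; apply/galgP=> x; rewrite !gE !ffunE mulrBl. Qed.
Fact ginr_zmod : zmod_morphism ginr.
Proof. by move=> f g; apply/galgP=> x; rewrite !gE !ffunE mulrBl. Qed.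

Fact ginl_monoid : monoid_morphism ginl.
Proof.
split=> [|f g]; apply/galgP=> -[x y].
  by rewrite !ffunE /= xpair_eqE; case: eqP; case: eqP.
rewrite [LHS]ffunE [RHS]gmulE /= gmulE.
transitivity (\sum_a \sum_b ginl f (a, b) * ginl g (x - a, y - b));
  last by rewrite pair_bigA /=; apply: eq_bigr => -[a b] _.
rewrite big_distrl /=; apply: eq_bigr => a _.
rewrite (bigD1 0) //= big1 ?addr0 => [|b /negPf b0].
  by rewrite !ffunE /= eqxx subr0 mulr1 mulrA.
by rewrite !ffunE /= b0 mulr0 mul0r.
Qed.
Fact ginr_monoid : monoid_morphism ginr.
Proof.
split=> [|f g]; apply/galgP=> -[x y].
  by rewrite !ffunE /= xpair_eqE; case: eqP; case: eqP.
rewrite [LHS]ffunE [RHS]gmulE /= gmulE.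
transitivity (\sum_a \sum_b ginr f (a, b) * ginr g (x - a, y - b));
  last by rewrite pair_bigA /=; apply: eq_bigr => -[a b] _.
rewrite exchange_big big_distrl /=; apply: eq_bigr => a _.
rewrite (bigD1 0) //= big1 ?addr0 => [|b /negPf b0].
  by rewrite !ffunE /= eqxx subr0 mulr1 mulrA.
by rewrite !ffunE /= b0 mulr0 mul0r.
Qed.

HB.instance Definition _ := GRing.isZmodMorphism.Build _ _ ginl ginl_zmod.
HB.instance Definition _ := GRing.isZmodMorphism.Build _ _ ginr ginr_zmod.
HB.instance Definition _ := GRing.isMonoidMorphism.Build _ _ ginl ginl_monoid.
HB.instance Definition _ := GRing.isMonoidMorphism.Build _ _ ginr ginr_monoid.

Lemma gone_pair : (gone : galg G) = ginl gone * ginr gone.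
Proof. by apply/galgP=> x; rewrite ginlrE !ffunE. Qed.

Lemma gstar_inl f : gstar (ginl f) = ginl (gstar f).
Proof. by apply/galgP=> x; rewrite !ffunE /= oppr_eq0. Qed.

Lemma gstar_inr f : gstar (ginr f) = ginr (gstar f).
Proof. by apply/galgP=> x; rewrite !ffunE /= oppr_eq0. Qed.

Lemma geven_inl f : geven f -> geven (ginl f).
Proof. by move=> ef x; rewrite !ffunE /= oppr_eq0 ef. Qed.

Lemma geven_inr f : geven f -> geven (ginr f).
Proof. by move=> ef x; rewrite !ffunE /= oppr_eq0 ef. Qed.

End Tensor.

(** * Hadamard matrices on finite index sets, and bordering *)

Lemma pm1_sq (x : int) : x = 1 \/ x = -1 -> x * x = 1.
Proof. by case=> ->. Qed.

Lemma pm1N (x : int) : x = 1 \/ x = -1 -> - x = 1 \/ - x = -1.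
Proof. by case=> ->; [right|left]. Qed.

Lemma pm1M (x y : int) : x = 1 \/ x = -1 -> y = 1 \/ y = -1 -> x * y = 1 \/ x * y = -1.
Proof. by case=> -> [] ->; [left|right|right|left]. Qed.

(** Arbitrary finite index types let products and [option] index blocks and borders without
    arithmetic on ordinals. *)
Definition hadamard_on (T : finType) (h : T -> T -> int) : Prop :=
  (forall i j, h i j = 1 \/ h i j = -1) /\
  (forall i i', \sum_j h i j * h i' j = (i == i')%:Z * #|T|%:Z).

Lemma hadamard_on_matrix (T : finType) (h : T -> T -> int) m :
  #|T| = m -> hadamard_on h -> exists M : 'M[int]_m, hadamard_matrix M.
Proof.
move=> <- [h1 h2]; exists (\matrix_(i, j) h (enum_val i) (enum_val j)); split.
  by move=> i j; rewrite mxE.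
apply/matrixP=> i k; rewrite !mxE.
under eq_bigr => j _ do rewrite !mxE.
rewrite -(big_enum_val (fun t => h (enum_val i) t * h (enum_val k) t)) /=.
rewrite h2 (inj_eq enum_val_inj); case: eqP => _ /=.
  by rewrite mul1r mulr1n natz.
by rewrite mul0r mulr0n.
Qed.

Lemma sum_option (T : finType) (R : zmodType) (F : option T -> R) :
  \sum_o F o = F None + \sum_t F (Some t).
Proof.
rewrite (bigD1 None) //=; congr (_ + _).
rewrite (reindex_omap Some id) /=; last by case.
by apply: eq_bigl => t; rewrite eqxx.
Qed.

Section Border.
Variables (I W : finType) (M : I -> W -> I -> W -> int) (rho : I -> I -> int).
Hypothesis M1 : forall i x j y, M i x j y = 1 \/ M i x j y = -1.
Hypothesis M2 : forall i x i' x', \sum_j \sum_y M i x j y * M i' x' j y =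
  (i == i')%:Z * (#|I|%:Z * (#|W|%:Z + 1) * (x == x')%:Z - #|I|%:Z).
Hypothesis M3 : forall i x j, \sum_y M i x j y = rho i j.

Section General.
Variables X U V : I -> I -> int.
Hypothesis X1 : forall i j, X i j = 1 \/ X i j = -1.
Hypothesis U1 : forall i j, U i j = 1 \/ U i j = -1.
Hypothesis V1 : forall i j, V i j = 1 \/ V i j = -1.
Hypothesis X2 : forall i i', \sum_j X i j * X i' j = (i == i')%:Z * #|I|%:Z.
Hypothesis U2 : forall i i', \sum_j U i j * U i' j = (i == i')%:Z * #|I|%:Z.
Hypothesis V2 : forall i i', \sum_j V i j * V i' j = (i == i')%:Z * #|I|%:Z.
Hypothesis XV : forall i i', \sum_j X i j * V i' j + \sum_j U i j * rho i' j = 0.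

(** [None] indexes the border row or column added to each block: X is the corner, U the top border
    and V the left border. *)
Let H (a b : I * option W) : int :=
  match a.2, b.2 with
  | None, None => X a.1 b.1
  | None, Some y => U a.1 b.1
  | Some x, None => V a.1 b.1
  | Some x, Some y => M a.1 x b.1 y
  end.

(** Distinct rows of M within a block have inner product -|I|, which V compensates by |I|; [XV] is
    the orthogonality of border rows to the other rows. *)
Lemma border_hadamard : hadamard_on H.
Proof.
split=> [[i [x|]] [j [y|]]|[i o] [i' o']]; rewrite /H //=.
rewrite card_prod card_option xpair_eqE PoszM -addn1 PoszD.
transitivity (\sum_j (H (i, o) (j, None) * H (i', o') (j, None) +
                      \sum_y H (i, o) (j, Some y) * H (i', o') (j, Some y))).
  under [RHS]eq_bigr => j _ do
    rewrite -(sum_option (fun p => H (i, o) (j, p) * H (i', o') (j, p))).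
  by rewrite pair_bigA; apply: eq_bigr => -[j y].
rewrite big_split; case: o o' => [x|] [x'|] /=; rewrite /H /=.
- rewrite V2 M2 //.
  by rewrite -[Some x == _]/(x == x'); case: (i == i'); case: (x == x') => /=; ring.
- rewrite andbF mul0r.
  rewrite (eq_bigr (fun j => X i' j * V i j)) => [|j _]; last exact: mulrC.
  rewrite [X in _ + X](eq_bigr (fun j => U i' j * rho i j)) ?XV // => j _.
  by rewrite -big_distrl /= M3 mulrC.
- rewrite andbF mul0r.
  rewrite [X in _ + X](eq_bigr (fun j => U i j * rho i' j)) ?XV // => j _.
  by rewrite -big_distrr /= M3.
- rewrite X2 andbT.
  rewrite (eq_bigr (fun j => U i j * U i' j * #|W|%:Z)) => [|j _].
    by rewrite -big_distrl /= U2; ring.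
  by rewrite sumr_const -[LHS]mulr_natr natz.
Qed.

Lemma border_hadamard_on : exists h : I * option W -> I * option W -> int, hadamard_on h.
Proof. by exists H; exact: border_hadamard. Qed.
End General.

(** A Hadamard matrix of block row sums can serve as both U and V, with X = - rho. *)
Lemma border_regular :
  (forall i j, rho i j = 1 \/ rho i j = -1) ->
  (forall i i', \sum_j rho i j * rho i' j = (i == i')%:Z * #|I|%:Z) ->
  exists h : I * option W -> I * option W -> int, hadamard_on h.
Proof.
move=> r1 r2.
apply: (@border_hadamard_on (fun i j => - rho i j) rho rho) => // [i j|i i'|i i'].
- exact: pm1N.
- by under eq_bigr => j _ do rewrite mulrNN.
- by under eq_bigr => j _ do rewrite mulNr; rewrite sumrN addNr.
Qed.
End Border.

(** Kronecker product with the Sylvester matrix of order 2. *)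
Lemma hadamard_double m : (exists M : 'M[int]_m, hadamard_matrix M) ->
  exists M : 'M[int]_(2 * m), hadamard_matrix M.
Proof.
case=> M [M1 M2].
pose h (a b : bool * 'I_m) : int := (if a.1 && b.1 then -1 else 1) * M a.2 b.2.
apply: (@hadamard_on_matrix _ h); first by rewrite card_prod card_bool card_ord.
split=> [[a i] [b j]|[a i] [a' i']]; rewrite /h /=.
  by apply: pm1M => //; case: ifP => _; [right|left].
transitivity ((\sum_(b : bool) (if a && b then -1 else 1) * (if a' && b then -1 else 1)) *
              (\sum_j M i j * M i' j)).
  rewrite big_distrlr /= pair_bigA; apply: eq_bigr => -[b j] _ /=.
  by rewrite mulrACA.
have -> : \sum_j M i j * M i' j = (i == i')%:Z * m%:Z.
  move/matrixP/(_ i i'): M2; rewrite !mxE => E.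
  under eq_bigr => j _ do rewrite -[M i' j](mxE (trmx_key) (fun a b => M b a) j i').
  by rewrite [LHS]E natz; case: eqP => _; rewrite ?mul1r ?mul0r ?mulr1n ?mulr0n.
rewrite big_bool xpair_eqE card_prod card_bool card_ord.
by case: a a' => [] []; case: eqP => //= _; lia.
Qed.

(** * Goethals-Seidel array *)

Section GoethalsSeidel.
Variable W : finZmodType.
Implicit Types f g : galg W.

Definition gcross f g s : int := \sum_y f y * g (y + s).

Lemma gcrossC f g s : gcross f g s = gcross g f (- s).
Proof.
rewrite /gcross (reindex_inj (addIr (- s))) /=.
by apply: eq_bigr => y _; rewrite addrNK mulrC.
Qed.

Lemma gcross_star f s : (f * gstar f) s = gcross f f s.
Proof.
by rewrite gmulE gcrossC; apply: eq_bigr => y _; rewrite ffunE opprB.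
Qed.

Lemma gcross_even f g s : geven f -> geven g -> gcross f g s = (f * g) s.
Proof.
move=> ef eg; rewrite -(gevenM ef eg) gmulE.
by apply: eq_bigr => y _; rewrite -(eg (- s - y)) opprB opprK addrC.
Qed.

Lemma cross11 f g x x' : \sum_y f (y - x) * g (y - x') = gcross f g (x - x').
Proof.
rewrite (reindex_inj (addIr x)) /=.
by apply: eq_bigr => y _; rewrite addrK addrA.
Qed.

Lemma cross22 f g x x' : \sum_y f (y + x) * g (y + x') = gcross f g (x' - x).
Proof.
rewrite (reindex_inj (addIr (- x))) /=.
by apply: eq_bigr => y _; rewrite addrNK -addrA [- x + _]addrC.
Qed.

Lemma cross33 f g x x' : \sum_y f (- y - x) * g (- y - x') = gcross f g (x - x').
Proof. by rewrite (reindex_inj oppr_inj) /= -cross11; under eq_bigr do rewrite opprK. Qed.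

Lemma cross23 f g x x' : \sum_y f (y + x) * g (- y - x') = (f * g) (x - x').
Proof.
rewrite gmulE (reindex_inj (addIr (- x))) /=.
by apply: eq_bigr => y _; rewrite addrNK opprB addrAC [x - x' - y]addrAC.
Qed.

Lemma cross32 f g x x' : \sum_y f (- y - x) * g (y + x') = (f * g) (x' - x).
Proof. by rewrite mulrC -cross23; apply: eq_bigr => y _; rewrite mulrC. Qed.

Lemma sumNl (F F' : W -> int) : \sum_y - F y * F' y = - \sum_y F y * F' y.
Proof. by rewrite -sumrN; apply: eq_bigr => y _; rewrite mulNr. Qed.

Lemma sumNr (F F' : W -> int) : \sum_y F y * - F' y = - \sum_y F y * F' y.
Proof. by rewrite -sumrN; apply: eq_bigr => y _; rewrite mulrN. Qed.

Lemma sumNN (F F' : W -> int) : \sum_y - F y * - F' y = \sum_y F y * F' y.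
Proof. by apply: eq_bigr => y _; rewrite mulrNN. Qed.

Variables a b c d : galg W.

(** With R the permutation x -> -x, the entries in y - x, - y - x and y + x are blocks of the form
    A, B R and B^T R for group-developed A and B. *)
Definition gs_entry (i : 'I_4) (x : W) (j : 'I_4) (y : W) : int :=
  match val i, val j with
  | 0, 0 => a (y - x) | 0, 1 => b (y + x) | 0, 2 => c (y + x) | 0, _ => d (y + x)
  | 1, 0 => - b (y + x) | 1, 1 => a (y - x) | 1, 2 => d (- y - x) | 1, _ => - c (- y - x)
  | 2, 0 => - c (y + x) | 2, 1 => - d (- y - x) | 2, 2 => a (y - x) | 2, _ => b (- y - x)
  | _, 0 => - d (y + x) | _, 1 => c (- y - x) | _, 2 => - b (- y - x) | _, _ => a (y - x)
  end.

Definition gs_sum (i j : 'I_4) : int :=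
  let s f := \sum_(y : W) f y in
  match val i, val j with
  | 0, 0 => s a | 0, 1 => s b | 0, 2 => s c | 0, _ => s d
  | 1, 0 => - s b | 1, 1 => s a | 1, 2 => s d | 1, _ => - s c
  | 2, 0 => - s c | 2, 1 => - s d | 2, 2 => s a | 2, _ => s b
  | _, 0 => - s d | _, 1 => s c | _, 2 => - s b | _, _ => s a
  end.

Lemma gs_rowsum i x j : \sum_y gs_entry i x j y = gs_sum i j.
Proof.
have s1 (f : galg W) : \sum_y f (y - x) = \sum_y f y.
  by rewrite [RHS](reindex_inj (addIr (- x))).
have s2 (f : galg W) : \sum_y f (y + x) = \sum_y f y.
  by rewrite [RHS](reindex_inj (addIr x)).
have s3 (f : galg W) : \sum_y f (- y - x) = \sum_y f y.
  by rewrite -[RHS]s1 [RHS](reindex_inj oppr_inj).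
by case: i j => [[|[|[|[|//]]]] ?] [[|[|[|[|//]]]] ?];
   rewrite /gs_entry /gs_sum /= ?sumrN ?s1 ?s2 ?s3.
Qed.

Hypothesis abcd1 : forall x, [/\ a x = 1 \/ a x = -1, b x = 1 \/ b x = -1,
  c x = 1 \/ c x = -1 & d x = 1 \/ d x = -1].
Hypothesis abcd2 : a * gstar a + b * gstar b + c * gstar c + d * gstar d =
  (4 * (#|W| + 1))%:R - gone *+ 4.

Lemma gs_entry1 i x j y : gs_entry i x j y = 1 \/ gs_entry i x j y = -1.
Proof.
have a1 z : a z = 1 \/ a z = -1 by case: (abcd1 z).
have b1 z : b z = 1 \/ b z = -1 by case: (abcd1 z).
have c1 z : c z = 1 \/ c z = -1 by case: (abcd1 z).
have d1 z : d z = 1 \/ d z = -1 by case: (abcd1 z).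
by case: i j => [[|[|[|[|//]]]] ?] [[|[|[|[|//]]]] ?];
   rewrite /gs_entry /=; try apply: pm1N.
Qed.

(** For two different block rows the terms cancel in pairs: either as a cross-correlation of f, g at
    s against that of g, f at -s, or because convolution is commutative. Within one block row the
    four autocorrelations add up. *)
Lemma gs_entry2 i x i' x' : \sum_j \sum_y gs_entry i x j y * gs_entry i' x' j y =
  (i == i')%:Z * (#|'I_4|%:Z * (#|W|%:Z + 1) * (x == x')%:Z - #|'I_4|%:Z).
Proof.
rewrite card_ord !big_ord_recl big_ord0.
have D : gcross a a (x - x') + gcross b b (x - x') + gcross c c (x - x') +
    gcross d d (x - x') = 4 * (#|W|%:Z + 1) * (x == x')%:Z - 4.
  rewrite -!gcross_star -!gaddE abcd2 !gE goneallE subr_eq0.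
  by rewrite PoszM PoszD.
have e1 : - x' - x = - (x + x') by rewrite opprD addrC.
have e2 : - x - x' = - (x + x') by rewrite opprD.
have e3 : x' - - x = x + x' by rewrite opprK addrC.
have e4 : - x' - - x = x - x' by rewrite opprK addrC.
have e5 : x' - x = - (x - x') by rewrite opprB.
have crossN f g s : gcross f g (- s) = gcross g f s by rewrite gcrossC opprK.
(* Reading y - x as y + (- x), the four rules for sums in y + x and - y - x also cover the diagonal
   blocks. *)
case: i i' => [[|[|[|[|//]]]] ?] [[|[|[|[|//]]]] ?];
rewrite /gs_entry -val_eqE /= ?(sumNN, sumNl, sumNr)
  ?(cross22, cross33, cross23, cross32) ?mul0r ?mul1r ?addr0 -?D
  ?e1 ?e2 ?e3 ?e4 ?e5 ?crossN
  ?(mulrC b a) ?(mulrC c a) ?(mulrC d a) ?(mulrC c b) ?(mulrC d b) ?(mulrC d c); ring.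
Qed.

Lemma gs_hadamard (X U V : 'I_4 -> 'I_4 -> int) :
  (forall i j, X i j = 1 \/ X i j = -1) ->
  (forall i j, U i j = 1 \/ U i j = -1) ->
  (forall i j, V i j = 1 \/ V i j = -1) ->
  (forall i i', \sum_j X i j * X i' j = (i == i')%:Z * #|'I_4|%:Z) ->
  (forall i i', \sum_j U i j * U i' j = (i == i')%:Z * #|'I_4|%:Z) ->
  (forall i i', \sum_j V i j * V i' j = (i == i')%:Z * #|'I_4|%:Z) ->
  (forall i i', \sum_j X i j * V i' j + \sum_j U i j * gs_sum i' j = 0) ->
  exists M : 'M[int]_(4 * (#|W| + 1)), hadamard_matrix M.
Proof.
move=> X1 U1 V1 X2 U2 V2 XV.
have [h] := border_hadamard_on gs_entry1 gs_entry2 gs_rowsum X1 U1 V1 X2 U2 V2 XV.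
by apply: hadamard_on_matrix; rewrite card_prod card_option card_ord addn1.
Qed.

(** For sums 1 or -1 the matrix [gs_sum] is the Williamson array on four signs, itself a Hadamard
    matrix of order 4. *)
Lemma gs_hadamard_odd :
  let s f := \sum_y f y in
  [/\ s a = 1 \/ s a = -1, s b = 1 \/ s b = -1, s c = 1 \/ s c = -1
    & s d = 1 \/ s d = -1] ->
  exists M : 'M[int]_(4 * (#|W| + 1)), hadamard_matrix M.
Proof.
move=> /= [sa sb sc sd].
have g1 i j : gs_sum i j = 1 \/ gs_sum i j = -1.
  by case: i j => [[|[|[|[|//]]]] ?] [[|[|[|[|//]]]] ?];
     rewrite /gs_sum /=; try apply: pm1N.
have g2 i i' : \sum_j gs_sum i j * gs_sum i' j = (i == i')%:Z * #|'I_4|%:Z.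
  rewrite card_ord !big_ord_recl big_ord0.
  by case: i i' => [[|[|[|[|//]]]] ?] [[|[|[|[|//]]]] ?]; rewrite /gs_sum -val_eqE /=;
     case: sa => ->; case: sb => ->; case: sc => ->; case: sd => ->.
have [h] := border_regular gs_entry1 gs_entry2 gs_rowsum g1 g2.
by apply: hadamard_on_matrix; rewrite card_prod card_option card_ord addn1.
Qed.

(** For even |W| the four sums are even with squares adding up to 4, so [gs_sum] is no sign matrix
    and another border is required. *)
Lemma gs_hadamard_even :
  [/\ \sum_y a y = 2, \sum_y b y = 0, \sum_y c y = 0 & \sum_y d y = 0] ->
  exists M : 'M[int]_(4 * (#|W| + 1)), hadamard_matrix M.
Proof.
move=> [sa sb sc sd].
(* The row sums are [rho = 2 I]; for [V = J - 2 I] the orthogonality condition of [border_hadamard]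
   reads [X = - U V / 2]. *)
pose sg (t : seq (seq bool)) (i j : 'I_4) : int := (-1) ^+ nth false (nth [::] t i) j.
pose T := true; pose F := false.
pose X := sg [:: [:: T; T; T; T]; [:: F; F; T; T]; [:: F; T; F; T]; [:: F; T; T; F]].
pose U := sg [:: [:: F; F; F; F]; [:: F; F; T; T]; [:: F; T; F; T]; [:: F; T; T; F]].
pose V := sg [:: [:: T; F; F; F]; [:: F; T; F; F]; [:: F; F; T; F]; [:: F; F; F; T]].
have sg1 t i j : sg t i j = 1 \/ sg t i j = -1.
  by rewrite /sg; case: (nth _ _ _); [right|left].
apply: (@gs_hadamard X U V) => [i j|i j|i j|i i'|i i'|i i'|i i']; try exact: sg1;
  rewrite ?card_ord !big_ord_recl !big_ord0;
  case: i i' => [[|[|[|[|//]]]] ?] [[|[|[|[|//]]]] ?];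
  by rewrite /gs_sum /= ?sa ?sb ?sc ?sd.
Qed.
End GoethalsSeidel.

(** * Orthogonal design of order 8 *)

Section OctonionDesign.

(* Left multiplication of the octonions: entry (i, j) is the sign of [e_(i xor j) e_j]. *)
Definition od8_sign (i j : 'I_8) : bool := nth false (nth [::]
  (map (map (eq_op 1%N)) [:: [:: 0; 1; 1; 1; 1; 1; 1; 1]; [:: 0; 0; 1; 0; 1; 0; 0; 1];
  [:: 0; 0; 0; 1; 1; 1; 0; 0]; [:: 0; 1; 0; 0; 1; 0; 1; 0];
  [:: 0; 0; 0; 0; 0; 1; 1; 1]; [:: 0; 1; 0; 1; 0; 0; 0; 1];
  [:: 0; 1; 1; 0; 0; 1; 0; 0]; [:: 0; 0; 1; 1; 0; 0; 1; 0]])%N i) j.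

(** Bitwise exclusive or, tabulated so that the case analysis computes. *)
Definition od8_index (i j : 'I_8) : nat := nth 0%N (nth [::]
  [:: [:: 0; 1; 2; 3; 4; 5; 6; 7]; [:: 1; 0; 3; 2; 5; 4; 7; 6];
  [:: 2; 3; 0; 1; 6; 7; 4; 5]; [:: 3; 2; 1; 0; 7; 6; 5; 4];
  [:: 4; 5; 6; 7; 0; 1; 2; 3]; [:: 5; 4; 7; 6; 1; 0; 3; 2];
  [:: 6; 7; 4; 5; 2; 3; 0; 1]; [:: 7; 6; 5; 4; 3; 2; 1; 0]]%N i) j.

(** The norm of the octonions is multiplicative, so left multiplication by an octonion is a
    similarity and its matrix has orthogonal rows. *)
Lemma od8_orthogonal (R : comNzRingType) (f : nat -> R) (i i' : 'I_8) :
  \sum_j ((-1) ^+ od8_sign i j * f (od8_index i j)) *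
         ((-1) ^+ od8_sign i' j * f (od8_index i' j)) =
  (\sum_(k < 8) f k * f k) *+ (i == i').
Proof.
rewrite !big_ord_recl !big_ord0.
by case: i i' => [[|[|[|[|[|[|[|[|//]]]]]]]] ?] [[|[|[|[|[|[|[|[|//]]]]]]]] ?];
   rewrite -val_eqE /od8_sign /od8_index /bump /= ?expr0 ?expr1 ?mulr1n ?mulr0n; ring.
Qed.

Variables (W : finZmodType) (f : nat -> galg W).
Hypothesis f_even : forall k, geven (f k).
Hypothesis f1 : forall k x, (k < 8)%N -> f k x = 1 \/ f k x = -1.
Hypothesis f_sum1 : forall k, (k < 8)%N -> \sum_x f k x = 1 \/ \sum_x f k x = -1.
Hypothesis f2 : \sum_(k < 8) f k * f k = (8 * (#|W| + 1))%:R - gone *+ 8.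

Lemma od8_index_lt i j : (od8_index i j < 8)%N.
Proof.
by case: i j => [[|[|[|[|[|[|[|[|//]]]]]]]] ?] [[|[|[|[|[|[|[|[|//]]]]]]]] ?].
Qed.

Let M (i : 'I_8) x (j : 'I_8) y : int := (-1) ^+ od8_sign i j * f (od8_index i j) (y - x).

(** Even functions give symmetric commuting blocks, so they may replace the variables of the design.
    The row sums form the same design on signs, and [border_regular] applies. *)
Lemma od8_hadamard : exists M : 'M[int]_(8 * (#|W| + 1)), hadamard_matrix M.
Proof.
have s1 (b : bool) : (-1) ^+ b = 1 \/ (-1) ^+ b = -1 :> int by case: b; [right|left].
have M1 i x j y : M i x j y = 1 \/ M i x j y = -1.
  apply: pm1M; first exact: s1.
  by apply: f1; exact: od8_index_lt.
pose rho i j : int := (-1) ^+ od8_sign i j * \sum_x f (od8_index i j) x.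
have M3 i x j : \sum_y M i x j y = rho i j.
  by rewrite /M -big_distrr /= /rho [in RHS](reindex_inj (addIr (- x))).
have r1 i j : rho i j = 1 \/ rho i j = -1.
  apply: pm1M; first exact: s1.
  by apply: f_sum1; exact: od8_index_lt.
have r2 i i' : \sum_j rho i j * rho i' j = (i == i')%:Z * #|'I_8|%:Z.
  rewrite (od8_orthogonal (fun k => \sum_x f k x)) card_ord.
  rewrite (eq_bigr (fun=> 1)) => [|k _]; last exact/pm1_sq/f_sum1.
  by rewrite sumr_const card_ord; case: (i == i').
have sgE (b : bool) (g : galg W) z : ((-1) ^+ b * g) z = (-1) ^+ b * g z.
  by case: b; rewrite ?expr0 ?expr1 ?mul1r // !mulN1r gE.
have M2 i x i' x' : \sum_j \sum_y M i x j y * M i' x' j y =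
    (i == i')%:Z * (#|'I_8|%:Z * (#|W|%:Z + 1) * (x == x')%:Z - #|'I_8|%:Z).
  transitivity ((\sum_j ((-1) ^+ od8_sign i j * f (od8_index i j)) *
         ((-1) ^+ od8_sign i' j * f (od8_index i' j))) (x - x')).
    rewrite gsumE; apply: eq_bigr => j _.
    rewrite gmulE (reindex_inj (addIr x)) [RHS](reindex_inj oppr_inj) /=.
    apply: eq_bigr => y _.
    by rewrite !sgE /M addrK f_even opprK [x - x' + y]addrC addrA.
  rewrite od8_orthogonal f2 card_ord; case: (i == i'); last by rewrite mulr0n gE mul0r.
  by rewrite mulr1n mul1r !gE goneallE subr_eq0 PoszM PoszD.
have [h] := border_regular M1 M2 M3 r1 r2.
by apply: hadamard_on_matrix; rewrite card_prod card_option card_ord addn1.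
Qed.
End OctonionDesign.

(** * Characters of finite fields *)

Section FiniteFieldSums.
Variable F : finFieldType.

(** For x != 0, substituting x / y for y leaves the sum of h (y - 1) over y != 0, which is the zero
    total of h less h (-1). Both the quadratic and the quartic character are instances. *)
Lemma sum_ratio (B : F -> F -> int) (h : F -> int) x :
  (forall z, B 0 z = 0) -> (forall y z, y != 0 -> B y z = h (z / y)) ->
  \sum_y h y = 0 ->
  \sum_y B y (x - y) = h (-1) * (#|F|%:Z * (x == 0)%:Z - 1).
Proof.
move=> B0 Bh h0.
have -> : \sum_y B y (x - y) = \sum_(y | y != 0) h (x / y - 1).
  rewrite (bigD1 0) //= B0 add0r; apply: eq_bigr => y y0.
  by rewrite Bh // mulrBl divff.
have [->|x0] := eqVneq x 0.
  rewrite (eq_bigr (fun=> h (-1))) => [|y _]; last by rewrite mul0r sub0r.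
  rewrite sumr_const -mulr_natr natz; congr (_ * _).
  have -> : #|[pred y : F | y != 0]| = #|F|.-1 by rewrite cardC1.
  by have : (0 < #|F|)%N by [apply/card_gt0P; exists 0]; lia.
rewrite (reindex_onto (fun y => x / y) (fun y => x / y)) => [|y y0]; last first.
  by rewrite invfM invrK mulrA divff // mul1r.
rewrite (eq_big (fun y => y != 0) (fun y => h (y - 1))) => [|y|y]; last first.
- by move=> /andP[_ /eqP->].
- have [->|y0] := eqVneq y 0; first by rewrite invr0 mulr0 eqxx.
  by rewrite mulf_neq0 ?invr_neq0 // invfM invrK mulrA divff // mul1r eqxx.
rewrite mulr0 sub0r mulrN1; apply/eqP; rewrite -addr_eq0 addrC; apply/eqP.
by rewrite -[RHS]h0 [RHS](reindex_inj (addIr (-1))) [RHS](bigD1 0) //= add0r.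
Qed.

Lemma expf_card_pred (x : F) : x != 0 -> x ^+ #|F|.-1 = 1.
Proof.
move=> x0; apply: (mulfI x0); rewrite -exprS mulr1 prednK ?expf_card //.
by apply/card_gt0P; exists 0.
Qed.

Hypothesis F_odd : odd #|F|.

Let F_gt2 : (2 < #|F|)%N.
Proof. by have := card_finNzRing_gt1 F; case: #|F| F_odd => [|[|[]]]. Qed.

Lemma half_card_pred : ((#|F|.-1)./2).*2 = #|F|.-1.
Proof. by rewrite -[RHS]odd_double_half; move: F_odd F_gt2; lia. Qed.

Lemma two_neq0 : (2%:R : F) != 0.
Proof.
apply/eqP => two0; have : (#|F|%:R : F) = 0.
  (* Translation by 1 permutes F, so the sum of all elements is unchanged by adding |F|. *)
  apply: (addrI (\sum_(x : F) x)); rewrite addr0 [RHS](reindex_inj (addIr 1)) big_split.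
  by rewrite sumr_const.
rewrite -[#|F|]odd_double_half F_odd -mul2n natrD natrM two0 mul0r addr0.
exact/eqP/oner_neq0.
Qed.

Lemma opp1_neq1 : (-1 : F) != 1.
Proof. by rewrite -subr_eq0 -opprD oppr_eq0 -[1 + 1]/(2%:R) two_neq0. Qed.

Definition qpow (x : F) := x ^+ (#|F|.-1)./2.

(** The quadratic character through Euler's criterion, which makes multiplicativity immediate. *)
Definition qchar (x : F) : int :=
  if x == 0 then 0 else if qpow x == 1 then 1 else -1.

Lemma qpow_sq x : x != 0 -> qpow x ^+ 2 = 1.
Proof. by move=> x0; rewrite -exprM muln2 half_card_pred expf_card_pred. Qed.

Lemma qpow_pm1 x : x != 0 -> qpow x = 1 \/ qpow x = -1.
Proof.
by move/qpow_sq/eqP; rewrite sqrf_eq1 => /orP[]/eqP; [left|right].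
Qed.

Lemma qchar0 : qchar 0 = 0. Proof. by rewrite /qchar eqxx. Qed.

Lemma qchar_pm1 x : x != 0 -> qchar x = 1 \/ qchar x = -1.
Proof. by rewrite /qchar => /negPf->; case: ifP; [left|right]. Qed.

Lemma qcharM x y : qchar (x * y) = qchar x * qchar y.
Proof.
rewrite /qchar mulf_eq0; case: (eqVneq x 0) => [|x0]; first by rewrite mul0r.
case: (eqVneq y 0) => [|y0] /=; first by rewrite mulr0.
have -> : qpow (x * y) = qpow x * qpow y by rewrite /qpow exprMn.
by case: (qpow_pm1 x0) => ->; case: (qpow_pm1 y0) => ->;
  rewrite ?mulrNN ?mul1r ?mulr1 ?eqxx ?(negPf opp1_neq1).
Qed.

Lemma qchar1 : qchar 1 = 1.
Proof. by rewrite /qchar oner_eq0 /qpow expr1n eqxx. Qed.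

Lemma qcharV x : qchar x^-1 = qchar x.
Proof.
have [->|x0] := eqVneq x 0; first by rewrite invr0.
have := qcharM x x^-1; rewrite divff // qchar1.
by have [->|->] := qchar_pm1 x0; have [->|->] : qchar x^-1 = 1 \/ qchar x^-1 = -1
  by apply: qchar_pm1; rewrite invr_neq0.
Qed.

Lemma qchar_div x y : qchar (x / y) = qchar x * qchar y.
Proof. by rewrite qcharM qcharV. Qed.

(** Otherwise X^((q-1)/2) - 1 would have q - 1 roots. *)
Lemma nonresidue_ex : exists nu : F, qpow nu = -1.
Proof.
case: (pickP (fun nu => qpow nu == -1)) => [nu /eqP|nE]; first by exists nu.
have h0 : (0 < (#|F|.-1)./2)%N by move: F_gt2; lia.
have p0 : ('X^((#|F|.-1)./2) - 1 : {poly F}) != 0.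
  by rewrite -size_poly_gt0 size_XnsubC.
have := max_poly_roots p0 (rs := enum (predC1 (0 : F))).
rewrite enum_uniq -cardE cardC1 size_XnsubC //.
move=> /(_ _ isT) H; have : (#|F|.-1 < ((#|F|.-1)./2).+1)%N.
  apply: H; apply/allP => x; rewrite mem_enum => x0.
  rewrite rootE !hornerE subr_eq0 -/(qpow x).
  by case: (qpow_pm1 x0) => [->|e] //; have := nE x; rewrite /= e eqxx.
by have := half_card_pred; move: F_gt2; lia.
Qed.

Lemma nonresidue_neq0 nu : qpow nu = -1 -> nu != 0.
Proof.
move=> e; apply/eqP => nu0; move: e; rewrite nu0 /qpow expr0n.
have -> : ((#|F|.-1)./2 == 0)%N = false by move: F_gt2; lia.
by move/esym/eqP; rewrite oppr_eq0 oner_eq0.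
Qed.

Lemma qchar_nonresidue nu : qpow nu = -1 -> qchar nu = -1.
Proof.
move=> e; rewrite /qchar (negPf (nonresidue_neq0 e)) e.
by rewrite (negPf opp1_neq1).
Qed.

Lemma sum_qchar : \sum_x qchar x = 0.
Proof.
have [nu e] := nonresidue_ex.
have : \sum_x qchar x = - \sum_x qchar x.
  rewrite {1}(reindex_inj (mulfI (nonresidue_neq0 e))) -sumrN.
  by apply: eq_bigr => x _; rewrite qcharM qchar_nonresidue // mulN1r.
lia.
Qed.

Lemma qcharN1 : (#|F| %% 4 = 1)%N -> qchar (-1) = 1.
Proof.
move=> F4; rewrite /qchar oppr_eq0 oner_eq0 /qpow -signr_odd.
by rewrite (_ : odd _ = false) ?expr0 ?eqxx //; lia.
Qed.

Lemma qcharN1_3 : (#|F| %% 4 = 3)%N -> qchar (-1) = -1.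
Proof.
move=> F4; rewrite /qchar oppr_eq0 oner_eq0 /qpow -signr_odd.
by rewrite (_ : odd _ = true) ?expr1 ?(negPf opp1_neq1) //; lia.
Qed.

Definition gqchar : galg F := [ffun x => qchar x].

Lemma gqchar_star : gqchar * gstar gqchar = (#|F|)%:R - gone.
Proof.
apply/galgP => x; rewrite gcross_star /gcross !gE goneallE.
(* Extracting the factor [qchar (-1)] turns the correlation into a convolution at -x; [sum_ratio]
   contributes the same factor again and the two cancel. *)
under eq_bigr => y _ do rewrite !ffunE -[y + x]opprK -mulN1r qcharM mulrCA.
rewrite -big_distrr /= -[x]opprK.
under eq_bigr => y _ do rewrite opprD addrC opprK.
rewrite (@sum_ratio (fun y z => qchar y * qchar z) qchar) => [|z|y z _|].
- by rewrite opprK oppr_eq0 mulrA pm1_sq ?mul1r //; by apply: qchar_pm1; rewrite oppr_eq0 oner_eq0.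
- by rewrite qchar0 mul0r.
- by rewrite qchar_div mulrC.
- exact: sum_qchar.
Qed.

Lemma gqchar_sum : \sum_x gqchar x = 0.
Proof. by rewrite -[RHS]sum_qchar; apply: eq_bigr => x _; rewrite ffunE. Qed.

Lemma gqchar_even : (#|F| %% 4 = 1)%N -> geven gqchar.
Proof. by move=> F4 x; rewrite !ffunE -mulN1r qcharM qcharN1 // mul1r. Qed.
End FiniteFieldSums.

(** * Paley's two constructions *)

Lemma paley1 (F : finFieldType) : (#|F| %% 4 = 3)%N ->
  exists M : 'M[int]_(1 * (#|F| + 1)), hadamard_matrix M.
Proof.
move=> F4; have Fodd : odd #|F| by lia.
(* Here the character is odd, so (chi - 1)(- chi - 1) = 1 - chi^2 has no linear term. *)
pose f : galg F := gqchar F - 1.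
have f1 x : f x = 1 \/ f x = -1.
  rewrite !gE ffunE; have [->|x0] := eqVneq x 0; first by rewrite qchar0; right.
  by rewrite subr0; exact: qchar_pm1.
have sN : gstar (gqchar F) = - gqchar F.
  by apply/galgP => x; rewrite gE !ffunE -mulN1r qcharM // qcharN1_3 // mulN1r.
have f2 : f * gstar f = (#|F| + 1)%:R - gone.
  rewrite gstarD gstarN (gstar_even (@geven1 _)) natrD.
  have := gqchar_star Fodd; rewrite sN /f => e.
  by transitivity (gqchar F * (- gqchar F) + 1); [ring | rewrite e; ring].
have fs : \sum_x f x = -1.
  rewrite (eq_bigr (fun x => gqchar F x - (x == 0)%:Z)) => [|x _]; last by rewrite !gE.
  by rewrite sumrB gqchar_sum // (bigD1 0) //= big1 ?eqxx // => x /negPf->.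
pose M (_ : 'I_1) x (_ : 'I_1) y : int := f (y - x).
have M2 i x i' x' : \sum_j \sum_y M i x j y * M i' x' j y =
    (i == i')%:Z * (#|'I_1|%:Z * (#|F|%:Z + 1) * (x == x')%:Z - #|'I_1|%:Z).
  rewrite big_ord1 /M cross11 -gcross_star f2 !gE goneallE subr_eq0 !ord1 card_ord.
  by rewrite eqxx !mul1r PoszD.
have M3 i x j : \sum_y M i x j y = -1.
  by rewrite -fs [RHS](reindex_inj (addIr (- x))).
have [||h] := @border_regular _ _ M (fun _ _ => -1) (fun _ _ _ _ => f1 _) M2 M3.
- by right.
- by move=> i i'; rewrite big_ord1 !ord1 card_ord eqxx.
by apply: hadamard_on_matrix; rewrite card_prod card_option card_ord addn1.
Qed.

(** The character c is even, and the blocks form c [[1,1],[1,-1]] + [[1,-1],[-1,-1]]; the second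
    matrix collects the row sums and is Hadamard of order 2. *)
Lemma paley2 (F : finFieldType) : (#|F| %% 4 = 1)%N ->
  exists M : 'M[int]_(2 * (#|F| + 1)), hadamard_matrix M.
Proof.
move=> F4; have Fodd : odd #|F| by lia.
pose c := gqchar F; have ce : geven c by exact: gqchar_even.
have c2 : c * c = #|F|%:R - gone by rewrite -[X in _ * X](gstar_even ce) gqchar_star.
have cs : \sum_x c x = 0 by exact: gqchar_sum.
pose f (i j : 'I_2) : galg F :=
  if (i == 0) && (j == 0) then c + 1 else if (i == 0) || (j == 0) then c - 1 else - c - 1.
have f1 i j x : f i j x = 1 \/ f i j x = -1.
  have : c x + (x == 0)%:Z = 1 \/ c x + (x == 0)%:Z = -1.
    rewrite !ffunE; have [->|x0] := eqVneq x 0; first by rewrite qchar0; left.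
    by rewrite addr0; exact: qchar_pm1.
  have : c x - (x == 0)%:Z = 1 \/ c x - (x == 0)%:Z = -1.
    rewrite !ffunE; have [->|x0] := eqVneq x 0; first by rewrite qchar0; right.
    by rewrite subr0; exact: qchar_pm1.
  by rewrite /f; case: ifP => _; [|case: ifP => _]; rewrite !gE; lia.
have fe i j : geven (f i j).
  rewrite /f; case: ifP => _; [|case: ifP => _]; do ?apply: gevenD => //;
  do ?apply: gevenN => //; exact: geven1.
pose r (i j : 'I_2) : int := if (i == 0) && (j == 0) then 1 else -1.
have fs i j : \sum_x f i j x = r i j.
  have s1 : \sum_x (1 : galg F) x = 1.
    rewrite (bigD1 0) //= big1 ?goneE ?eqxx // => x /negPf e.
    by rewrite goneE e.
  have sD (g h : galg F) : \sum_x (g + h) x = \sum_x g x + \sum_x h x.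
    by rewrite -big_split; apply: eq_bigr => x _; rewrite gE.
  have sN (g : galg F) : \sum_x (- g) x = - \sum_x g x.
    by rewrite -sumrN; apply: eq_bigr => x _; rewrite gE.
  by rewrite /f /r; do 2?case: ifP => //= _; rewrite ?(sD, sN) cs s1.
pose M i x j y : int := f i j (y - x).
have M2 i x i' x' : \sum_j \sum_y M i x j y * M i' x' j y =
    (i == i')%:Z * (#|'I_2|%:Z * (#|F|%:Z + 1) * (x == x')%:Z - #|'I_2|%:Z).
  transitivity ((\sum_j f i j * f i' j) (x - x')).
    rewrite gsumE; apply: eq_bigr => j _.
    by rewrite /M cross11 gcross_even.
  rewrite !big_ord_recl big_ord0.
  have l1 : (lift ord0 ord0 == 0 :> 'I_2) = false by [].
  have -> : f i (lift ord0 ord0) = if i == 0 then c - 1 else - c - 1 by rewrite /f l1 andbF orbF.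
  have -> : f i' (lift ord0 ord0) = if i' == 0 then c - 1 else - c - 1 by rewrite /f l1 andbF orbF.
  rewrite card_ord; have e : c * c + 1 = (#|F| + 1)%:R - gone by rewrite c2 natrD; ring.
  have k : (c * c + 1) *+ 2 = (c + 1) * (c + 1) + ((c - 1) * (c - 1) + 0) by ring.
  have k' : (c * c + 1) *+ 2 = (c - 1) * (c - 1) + ((- c - 1) * (- c - 1) + 0) by ring.
  have z : (c + 1) * (c - 1) + ((c - 1) * (- c - 1) + 0) = 0 by ring.
  have z' : (c - 1) * (c + 1) + ((- c - 1) * (c - 1) + 0) = 0 by ring.
  case: i i' => [[|[|//]] ?] [[|[|//]] ?]; rewrite /f -!val_eqE /= -?k -?k' ?z ?z' ?e
    !gE ?goneallE ?subr_eq0 ?mul0r // PoszD mul1r; case: (x == x'); rewrite /= ?mulr1 ?mulr0; lia.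
have M3 i x j : \sum_y M i x j y = r i j.
  by rewrite -fs [RHS](reindex_inj (addIr (- x))).
have [||h] := @border_regular _ _ M r (fun _ _ _ _ => f1 _ _ _) M2 M3.
- by move=> i j; rewrite /r; case: ifP; [left|right].
- move=> i i'; rewrite !big_ord_recl big_ord0 card_ord.
  by case: i i' => [[|[|//]] ?] [[|[|//]] ?].
by apply: hadamard_on_matrix; rewrite card_prod card_option card_ord addn1.
Qed.

(** * Hadamard matrices from quadruples of group ring elements *)

Section Augmentation.
Variable G : finZmodType.

Definition gaug (f : galg G) : int := \sum_x f x.

Fact gaug_zmod : zmod_morphism gaug.
Proof. by move=> f g; rewrite /gaug -sumrB; apply: eq_bigr => x _; rewrite !gE. Qed.

Fact gaug_monoid : monoid_morphism gaug.
Proof.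
split=> [|f g]; rewrite /gaug.
  rewrite (bigD1 0) //= big1 ?goneE ?eqxx // => x /negPf x0.
  by rewrite goneE x0.
under eq_bigr => x _ do rewrite gmulE.
rewrite exchange_big big_distrl /=; apply: eq_bigr => y _.
by rewrite -big_distrr (reindex_inj (addIr y)) /=; under eq_bigr do rewrite addrK.
Qed.

HB.instance Definition _ := GRing.isZmodMorphism.Build _ _ gaug gaug_zmod.
HB.instance Definition _ := GRing.isMonoidMorphism.Build _ _ gaug gaug_monoid.

Lemma gaug_gone : gaug gone = #|G|%:Z.
Proof.
by rewrite /gaug (eq_bigr (fun=> 1)) => [|x _]; rewrite ?sumr_const ?natz ?goneallE.
Qed.
End Augmentation.

Lemma gaug_tensor (G1 G2 : finZmodType) (f : galg G1) (g : galg G2) :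
  gaug (ginl G2 f * ginr G1 g) = gaug f * gaug g.
Proof.
rewrite /gaug big_distrlr pair_bigA; apply: eq_bigr => -[x y] _.
by rewrite ginlrE.
Qed.

(** * Sequences over a cyclic group with values in Z[G] *)

Section CyclicExtension.
Variables (w : nat) (G : finZmodType).
Local Notation W := ('I_w.+2 * G)%type.
Implicit Types X : nat -> galg G.

(** A sequence of w + 2 elements of Z[G] becomes the polynomial with these coefficients in a
    generator T of the cyclic group. *)
Definition gcyc X : galg W := [ffun z => X (val z.1) z.2].

Definition gT : galg W := ginl G (gdelta (1 : 'I_w.+2)).

Lemma gT_exp k : gT ^+ k = ginl G (gdelta (k%:R : 'I_w.+2)).
Proof.
rewrite -rmorphXn; congr (ginl _ _); elim: k => [|k IH] //.
by rewrite exprS IH gdeltaD mulrS.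
Qed.

Let Zw0 : (w.+2%:R : 'I_w.+2) = 0.
Proof. exact: (@pchar_Zp w.+2). Qed.

Lemma gT_order : gT ^+ w.+2 = 1.
Proof. by rewrite gT_exp Zw0 rmorph1. Qed.

Lemma gstar_T : gstar gT = gT ^+ w.+1.
Proof.
rewrite gstar_inl gstar_delta gT_exp; congr (ginl _ (gdelta _)).
by apply/eqP; rewrite eq_sym -addr_eq0 -mulrSr Zw0.
Qed.

Lemma gcycE X : gcyc X = \sum_(k < w.+2) gT ^+ k * ginr _ (X k).
Proof.
apply/galgP => -[t x]; rewrite ffunE gsumE (bigD1 t) //= big1 => [|k /negPf kt].
  by rewrite gT_exp ginlrE ffunE /= Zp_nat valZpK eqxx mul1r addr0.
by rewrite gT_exp ginlrE ffunE /= Zp_nat valZpK eq_sym kt mul0r.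
Qed.

Lemma gone_cyc : (gone : galg W) = \sum_(k < w.+2) gT ^+ k * ginr _ gone.
Proof. by rewrite -(gcycE (fun=> gone)); apply/galgP => z; rewrite !ffunE. Qed.

Lemma gstar_cyc X : (forall k, geven (X k)) ->
  gstar (gcyc X) = \sum_(k < w.+2) (gT ^+ w.+1) ^+ k * ginr _ (X k).
Proof.
move=> eX; rewrite gcycE.
have -> (I : finType) (f : I -> galg W) : gstar (\sum_i f i) = \sum_i gstar (f i).
  elim/big_rec2: _ => [|i a b _ <-]; last by rewrite gstarD.
  by apply/galgP => z; rewrite !ffunE.
apply: eq_bigr => k _; rewrite gstarM gstar_inr (gstar_even (eX _)) -gstar_T.
congr (_ * _); elim: (k : nat) => [|j IH]; first exact/gstar_even/geven1.
by rewrite !exprS gstarM IH.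
Qed.

Lemma gaug_cyc X : gaug (gcyc X) = \sum_(k < w.+2) gaug (X k).
Proof.
rewrite /gaug pair_bigA; apply: eq_bigr => -[t x] _.
by rewrite ffunE.
Qed.

(** The generator is a parameter: T gives the element and T^(w+1), the inverse of T, its star, so
    that [ring] can compare both. *)
Definition gcyc_poly X (T : galg W) : galg W :=
  \sum_(0 <= k < w.+2) T ^+ k * ginr _ (X k).

Lemma gcyc_polyE X : gcyc X = gcyc_poly X gT.
Proof. by rewrite gcycE /gcyc_poly big_mkord. Qed.

Lemma gstar_cyc_polyE X : (forall k, geven (X k)) ->
  gstar (gcyc X) = gcyc_poly X (gT ^+ w.+1).
Proof. by move=> eX; rewrite gstar_cyc // /gcyc_poly big_mkord. Qed.

Lemma gone_cyc_polyE : (gone : galg W) = gcyc_poly (fun=> gone) gT.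
Proof. by rewrite gone_cyc /gcyc_poly big_mkord. Qed.
End CyclicExtension.

Section Quadruple.
Variables (G : finZmodType) (P R H K : galg G).

(* [P +- H] and [R +- K] are four +-1 valued functions. *)
Definition quadruple : Prop :=
  [/\ [/\ geven P, geven R, geven H & geven K],
      [/\ P 0 = 1, R 0 = 1, H 0 = 0 & K 0 = 0],
      forall x, x != 0 ->
        [/\ P x = 1 \/ P x = -1, K x = 1 \/ K x = -1, R x = 0 & H x = 0] \/
        [/\ R x = 1 \/ R x = -1, H x = 1 \/ H x = -1, P x = 0 & K x = 0]
    & [/\ P * P + R * R = #|G|%:R + gone, P * R = gone & H * H + K * K = #|G|%:R - gone]].

(** Augmentation of the three relations gives (aug P - aug R)^2 = 2 v - 2 v = 0, and a zero sum of
    squares for H and K. *)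
Lemma quadruple_aug : quadruple -> [/\ gaug P = gaug R, gaug H = 0 & gaug K = 0].
Proof.
move=> [_ _ _ [pr2 pr hk]].
have := congr1 (@gaug G) pr2; have := congr1 (@gaug G) pr; have := congr1 (@gaug G) hk.
rewrite !(rmorphD, rmorphN, rmorphM) /= gaug_gone rmorph_nat natz subrr => e1 e2 e3.
have : (gaug P - gaug R) * (gaug P - gaug R) = 0.
  transitivity (gaug P * gaug P + gaug R * gaug R - (gaug P * gaug R) *+ 2); first by ring.
  by rewrite e3 e2 mulr2n subrr.
by move/eqP; rewrite mulf_eq0 orbb subr_eq0 => /eqP ->; split=> //; nia.
Qed.

Variable c : galg G.
(** The core of a symmetric conference matrix of order v + 1, developed over G. *)
Definition conference_core : Prop :=
  [/\ geven c, c 0 = 0, forall x, x != 0 -> c x = 1 \/ c x = -1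
    & c * c = #|G|%:R - gone].

Hypothesis Q : quadruple.
Hypothesis C : conference_core.

Let A (i : nat) := match i with 0 => P + H | 1 => R + K | 2 => P - H | _ => R - K end.

Let A1 i x : A i x = 1 \/ A i x = -1.
Proof.
have [_ [p0 r0 h0 k0] q _] := Q.
have [->|/q pq] := eqVneq x 0.
  by case: i => [|[|[|i]]]; rewrite /A !gE ?p0 ?r0 ?h0 ?k0; left.
by case: i => [|[|[|i]]]; rewrite /A !gE; case: pq => -[? ? e3 e4]; rewrite ?e3 ?e4; lia.
Qed.

Let A_even i : geven (A i).
Proof.
by have [[? ? ? ?] _ _ _] := Q; case: i => [|[|[|i]]];
  apply: gevenD => //; apply: gevenN.
Qed.

Let cD1 x : (c + 1) x = 1 \/ (c + 1) x = -1.
Proof.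
have [_ c0 c1 _] := C; rewrite !gE; have [->|x0] := eqVneq x 0.
  by rewrite c0; left.
by rewrite addr0; exact: c1.
Qed.

Let cB1 x : (c - 1) x = 1 \/ (c - 1) x = -1.
Proof.
have [_ c0 c1 _] := C; rewrite !gE; have [->|x0] := eqVneq x 0.
  by rewrite c0; right.
by rewrite subr0; exact: c1.
Qed.

Let gN1 (f : galg G) : (forall x, f x = 1 \/ f x = -1) ->
  forall x, (- f) x = 1 \/ (- f) x = -1.
Proof. by move=> f1 x; rewrite gE; exact: pm1N. Qed.

Let c_even : geven (c + 1) /\ geven (c - 1).
Proof.
have [ec _ _ _] := C.
by split; apply: gevenD => //; last apply: gevenN; exact: geven1.
Qed.

Let aug0 : [/\ gaug c = 0, gaug H = 0 & gaug K = 0].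
Proof.
have [_ _ _ c2] := C; have [_ aH aK] := quadruple_aug Q.
have := congr1 (@gaug G) c2.
rewrite !(rmorphD, rmorphN, rmorphM) /= gaug_gone rmorph_nat natz subrr.
by move/eqP; rewrite mulf_eq0 orbb => /eqP.
Qed.

(** Solved for the squares of R, K and c, the relations serve as rewriting rules for [ring] in the
    larger group ring. *)
Let relations (S : comNzRingType) (phi : {rmorphism galg G -> S}) :
  [/\ phi R * phi R = #|G|%:R + phi gone - phi P * phi P,
      phi K * phi K = #|G|%:R - phi gone - phi H * phi H
    & phi c * phi c = #|G|%:R - phi gone].
Proof.
have [_ _ _ [e1 _ e2]] := Q; have [_ _ _ e3] := C.
rewrite -!rmorphM e3 -(rmorph_nat phi) -!(rmorphD, rmorphB).
by split=> //; congr (phi _); rewrite -?e1 -?e2; ring.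
Qed.

(* With A0, A2 = P +- H and A1, A3 = R +- K, the relations read
   A0^2 + A1^2 + A2^2 + A3^2 = 4 v and A0 A2 + A1 A3 = 2 J.  Since moreover
   (c + 1)^2 + (c - 1)^2 = 2 v + 2 - 2 J, the autocorrelations of the cyclic sequences chosen
   in the next three lemmas add up to a multiple of the identity minus 4 J. *)
Lemma hadamard_2v : exists M : 'M[int]_(4 * (2 * #|G| + 1)), hadamard_matrix M.
Proof.
have [ac ah ak] := aug0; have [ec1 ec2] := c_even.
(* In the first two sequences the T-terms (c + 1)(c - 1) cancel; the last two leave -(A0 A2 + A1 A3)
   = -2 J, which is doubled. *)
pose X i k := match i, k with
  | 0, 0 => c + 1 | 0, _ => - (c - 1) | 1, 0 => c + 1 | 1, _ => c - 1
  | 2, 0 => A 0 | 2, _ => - A 2 | _, 0 => A 1 | _, _ => - A 3 end.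
have eX i k : geven (X i k).
  have := And4 (A_even 0) (A_even 1) (A_even 2) (A_even 3).
  by case: i k => [|[|[|i]]] [|k] [? ? ? ?] /=; try apply: gevenN.
have X1 i k x : X i k x = 1 \/ X i k x = -1.
  have := And4 (A1 0) (A1 1) (A1 2) (A1 3).
  by case: i k => [|[|[|i]]] [|k] [? ? ? ?] /=; try apply: gN1.
have [] := @gs_hadamard_even _ (gcyc 0 (X 0)) (gcyc 0 (X 1)) (gcyc 0 (X 2)) (gcyc 0 (X 3)).
- by move=> x; rewrite !ffunE.
- rewrite !(gstar_cyc_polyE _ (eX _)) gone_cyc_polyE !gcyc_polyE.
  rewrite /gcyc_poly unlock /=.
  have [] := relations (@ginr 'I_2 G); rewrite card_prod card_ord.
  rewrite !(rmorphD, rmorphN, rmorph1) /= /bump /=.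
  (* What remains is a polynomial identity in commuting variables, modulo T^2 = 1 and the three
     relations. *)
  move: (gT 0 G) (gT_order 0 G) (ginr _ P) (ginr _ R) (ginr _ H) (ginr _ K).
  move: (ginr _ c) (ginr _ gone).

  move=> d j T T2 p r h k r2 k2 d2.
  ring: T2 r2 k2 d2.
- rewrite -!/(gaug _) !gaug_cyc !big_ord_recl !big_ord0 /=.
  by rewrite !(rmorphD, rmorphN, rmorph1) /= ac ah ak; split; lia.
by rewrite card_prod card_ord => M; exists M.
Qed.
Lemma hadamard_3v : exists M : 'M[int]_(4 * (3 * #|G| + 1)), hadamard_matrix M.
Proof.
have [ac ah ak] := aug0; have [ec1 ec2] := c_even.
(* Each sequence is paired with one differing only in the signs at T and T^2, which cancels the
   products with c + 1 and c - 1. *)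
pose X i k := match i, k with
  | 0, 0 => c + 1 | 0, 1 => A 0 | 0, _ => - A 2
  | 1, 0 => c + 1 | 1, 1 => - A 0 | 1, _ => A 2
  | 2, 0 => c - 1 | 2, 1 => A 1 | 2, _ => - A 3
  | _, 0 => c - 1 | _, 1 => - A 1 | _, _ => A 3 end.
have eX i k : geven (X i k).
  have := And4 (A_even 0) (A_even 1) (A_even 2) (A_even 3).
  by case: i k => [|[|[|i]]] [|[|k]] [? ? ? ?] /=; try apply: gevenN.
have X1 i k x : X i k x = 1 \/ X i k x = -1.
  have := And4 (A1 0) (A1 1) (A1 2) (A1 3).
  by case: i k => [|[|[|i]]] [|[|k]] [? ? ? ?] /=; try apply: gN1.
have [] := @gs_hadamard_odd _ (gcyc 1 (X 0)) (gcyc 1 (X 1)) (gcyc 1 (X 2)) (gcyc 1 (X 3)).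
- by move=> x; rewrite !ffunE.
- rewrite !(gstar_cyc_polyE _ (eX _)) gone_cyc_polyE !gcyc_polyE.
  rewrite /gcyc_poly unlock /=.
  have [] := relations (@ginr 'I_3 G); rewrite card_prod card_ord.
  rewrite !(rmorphD, rmorphN, rmorph1) /= /bump /=.
  move: (gT 1 G) (gT_order 1 G) (ginr _ P) (ginr _ R) (ginr _ H) (ginr _ K).
  move: (ginr _ c) (ginr _ gone).
  move=> d j T T2 p r h k r2 k2 d2.
  have -> : (T ^+ 2) ^+ 2 = T by rewrite -exprM (exprD T 3 1) T2 mul1r.
  ring: T2 r2 k2 d2.
- rewrite -!/(gaug _) !gaug_cyc !big_ord_recl !big_ord0 /=.
  by rewrite !(rmorphD, rmorphN, rmorph1) /= ac ah ak; split; lia.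
by rewrite card_prod card_ord => M; exists M.
Qed.

Lemma hadamard_5v : exists M : 'M[int]_(4 * (5 * #|G| + 1)), hadamard_matrix M.
Proof.
have [ac ah ak] := aug0; have [ec1 ec2] := c_even.
(* Sign pairing again removes the products with c + 1 and c - 1. Between the two patterns A0 A1, A2
   A3, A0 A3 and A1 A2 cancel, and each power of T keeps -(A0 A2 + A1 A3). *)
pose X i k := match i, k with
  | 0, 0 => c + 1 | 0, 1 => A 1 | 0, 2 => A 0 | 0, 3 => - A 2 | 0, _ => - A 3
  | 1, 0 => c + 1 | 1, 1 => - A 1 | 1, 2 => - A 0 | 1, 3 => A 2 | 1, _ => A 3
  | 2, 0 => c - 1 | 2, 1 => A 0 | 2, 2 => - A 1 | 2, 3 => A 3 | 2, _ => - A 2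
  | _, 0 => c - 1 | _, 1 => - A 0 | _, 2 => A 1 | _, 3 => - A 3 | _, _ => A 2 end.
have eX i k : geven (X i k).
  have := And4 (A_even 0) (A_even 1) (A_even 2) (A_even 3).
  by case: i k => [|[|[|i]]] [|[|[|[|k]]]] [? ? ? ?] /=; try apply: gevenN.
have X1 i k x : X i k x = 1 \/ X i k x = -1.
  have := And4 (A1 0) (A1 1) (A1 2) (A1 3).
  by case: i k => [|[|[|i]]] [|[|[|[|k]]]] [? ? ? ?] /=; try apply: gN1.
have [] := @gs_hadamard_odd _ (gcyc 3 (X 0)) (gcyc 3 (X 1)) (gcyc 3 (X 2)) (gcyc 3 (X 3)).
- by move=> x; rewrite !ffunE.
- rewrite !(gstar_cyc_polyE _ (eX _)) gone_cyc_polyE !gcyc_polyE.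
  rewrite /gcyc_poly unlock /=.
  have [] := relations (@ginr 'I_5 G); rewrite card_prod card_ord.
  rewrite !(rmorphD, rmorphN, rmorph1) /= /bump /=.
  move: (gT 3 G) (gT_order 3 G) (ginr _ P) (ginr _ R) (ginr _ H) (ginr _ K).
  move: (ginr _ c) (ginr _ gone).
  move=> d j T T2 p r h k r2 k2 d2.
  have -> : (T ^+ 4) ^+ 2 = T ^+ 3 by rewrite -exprM (exprD T 5 3) T2 mul1r.
  have -> : (T ^+ 4) ^+ 3 = T ^+ 2 by rewrite -exprM (exprD T 10 2) (exprM T 5 2) T2 expr1n mul1r.
  have -> : (T ^+ 4) ^+ 4 = T by rewrite -exprM (exprD T 15 1) (exprM T 5 3) T2 expr1n mul1r.
  ring: T2 r2 k2 d2.
- rewrite -!/(gaug _) !gaug_cyc !big_ord_recl !big_ord0 /=.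
  by rewrite !(rmorphD, rmorphN, rmorph1) /= ac ah ak; split; lia.
by rewrite card_prod card_ord => M; exists M.
Qed.

End Quadruple.

(** * Composition of two quadruples for the orders 8 (u v + 1) *)

Section DoubleQuadruple.
Variables (G1 G2 : finZmodType) (P R H K : galg G1) (p r h k : galg G2).
Hypothesis Q1 : quadruple P R H K.
Hypothesis Q2 : quadruple p r h k.
Local Notation W := (G1 * G2)%type.
Local Notation i1 := (@ginl G1 G2).
Local Notation i2 := (@ginr G1 G2).

(* Twice a {0, 1, -1}-valued element vanishing only at 0.  The signs are those of
   H and K, multiplied by [a] and [b], and of h and k, both multiplied by [a b]:
   summed over [a] and [b], all mixed terms of the squares cancel. *)
Let E (a b : bool) : galg W :=
  i1 (P + R) * i2 (p - r) + (-1) ^+ (a + b) * (i1 (P - R) * i2 (k - h)) +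
  (-1) ^+ a * (i1 H * i2 (p + r)) + (-1) ^+ b * (i1 K * i2 (p + r)) +
  (-1) ^+ b * (i1 H * i2 (k + h)) - (-1) ^+ a * (i1 K * i2 (k + h)).

Let sgE (b : nat) (f : galg W) z : ((-1) ^+ b * f) z = (-1) ^+ b * f z.
Proof.
elim: b => [|b IH]; first by rewrite !expr0 !mul1r.
by rewrite !exprS -!mulrA !mulN1r goppE IH.
Qed.

Let E_val a b z : if z == 0 then E a b z = 0 else E a b z = 2 \/ E a b z = -2.
Proof.
have [_ [P0 R0 H0 K0] q1 _] := Q1; have [_ [p0 r0 h0 k0] q2 _] := Q2.
case: z => x y; rewrite /E !gaddE goppE !sgE !ginlrE /= !gaddE !goppE xpair_eqE.
have [->|/q1 {}q1] := eqVneq x 0; have [->|/q2 {}q2] := eqVneq y 0;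
  rewrite ?P0 ?R0 ?H0 ?K0 ?p0 ?r0 ?h0 ?k0 /=.
- by case: a; case: b.
- by case: a; case: b; case: q2 => -[[->|->] [->|->] -> ->]; first [by left | by right].
- by case: a; case: b; case: q1 => -[[->|->] [->|->] -> ->]; first [by left | by right].
- by case: a; case: b; case: q1 => -[[->|->] [->|->] -> ->];
    case: q2 => -[[->|->] [->|->] -> ->]; first [by left | by right].
Qed.

(** The integer division is exact, all values of E being 0, 2 or -2. *)
Let D a b : galg W := [ffun z => (E a b z %/ 2)%Z].

Let D2 a b : D a b *+ 2 = E a b.
Proof.
apply/galgP => z; rewrite gmulrnE ffunE; have := E_val a b z.
by case: ifP => _ => [->|[->|->]].
Qed.

Let D0 a b : D a b 0 = 0.
Proof. by rewrite ffunE; have := E_val a b 0; rewrite eqxx => ->. Qed.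

Let D1 a b z : z != 0 -> D a b z = 1 \/ D a b z = -1.
Proof.
by rewrite ffunE; have := E_val a b z; case: ifP => // _ [->|->]; [left|right].
Qed.

Let D_even a b : geven (D a b).
Proof.
have [[? ? ? ?] _ _ _] := Q1; have [[? ? ? ?] _ _ _] := Q2.
have sg n (f : galg W) : geven f -> geven ((-1) ^+ n * f).
  by move=> ef z; rewrite !sgE ef.
suff eE : geven (E a b) by move=> z; rewrite [LHS]ffunE eE [RHS]ffunE.
by do ?[apply: gevenD | apply: gevenN | apply: sg | apply: gevenM
       | apply: geven_inl | apply: geven_inr].
Qed.

Let D_aug a b : gaug (D a b) = 0.
Proof.
have [e1 e2 e3] := quadruple_aug Q1; have [e4 e5 e6] := quadruple_aug Q2.
have : gaug (E a b) = 0.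
  have sg n (f : galg W) : gaug ((-1) ^+ n * f) = (-1) ^+ n * gaug f.
    by rewrite rmorphM rmorph_sign.
  rewrite /E !(rmorphD (@gaug _), rmorphN (@gaug _)) /= !sg !gaug_tensor.
  by rewrite !(rmorphD, rmorphN) /= e1 e2 e3 e4 e5 e6; ring.
by rewrite -D2 rmorphMn /= => /eqP; rewrite mulrn_eq0 => /eqP.
Qed.

Let sum_D_sq : D false false ^+ 2 + D false true ^+ 2 + D true false ^+ 2 + D true true ^+ 2 =
  (4 * (#|G1| * #|G2|))%:R - gone *+ 4.
Proof.
have [_ _ _ [e1 e2 e3]] := Q1; have [_ _ _ [e4 e5 e6]] := Q2.
apply: (@gmulrnI _ 4) => //.
transitivity (E false false ^+ 2 + E false true ^+ 2 + E true false ^+ 2 + E true true ^+ 2).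
  by rewrite -!D2; ring.
have r1 : i1 P * i1 P + i1 R * i1 R = #|G1|%:R + i1 gone.
  by rewrite -!rmorphM -(rmorph_nat i1) -!rmorphD e1.
have r2 : i1 P * i1 R = i1 gone by rewrite -rmorphM e2.
have r3 : i1 H * i1 H + i1 K * i1 K = #|G1|%:R - i1 gone.
  by rewrite -!rmorphM -(rmorph_nat i1) -rmorphB -rmorphD e3.
have r4 : i2 p * i2 p + i2 r * i2 r = #|G2|%:R + i2 gone.
  by rewrite -!rmorphM -(rmorph_nat i2) -!rmorphD e4.
have r5 : i2 p * i2 r = i2 gone by rewrite -rmorphM e5.
have r6 : i2 h * i2 h + i2 k * i2 k = #|G2|%:R - i2 gone.
  by rewrite -!rmorphM -(rmorph_nat i2) -rmorphB -rmorphD e6.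
rewrite /E gone_pair /nat_of_bool natrM natrM !(rmorphD, rmorphN) /=.
move: r1 r2 r3 r4 r5 r6.
move: (i1 P) (i1 R) (i1 H) (i1 K) (i1 gone) (i2 p) (i2 r) (i2 h) (i2 k) (i2 gone).
move=> P' R' H' K' J1 p' r' h' k' J2 r1 r2 r3 r4 r5 r6.
(* Summing over the signs removes products of terms with different signs; the two remaining products
   H K (p + r)(k + h) have opposite signs. *)
transitivity (
  ((P' * P' + R' * R' + (P' * R') *+ 2) * (p' * p' + r' * r' - (p' * r') *+ 2) +
   (P' * P' + R' * R' - (P' * R') *+ 2) * (h' * h' + k' * k' - (h' * k') *+ 2) +
   (H' * H' + K' * K') * (p' * p' + r' * r' + (p' * r') *+ 2) +
   (H' * H' + K' * K') * (h' * h' + k' * k' + (h' * k') *+ 2)) *+ 4); first by ring.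
by rewrite r1 r2 r3 r4 r5 r6; ring.
Qed.

Lemma hadamard_uv : exists M : 'M[int]_(8 * (#|G1| * #|G2| + 1)), hadamard_matrix M.
Proof.
(* The two low bits of i select one of the four D; each occurs once with + 1 and once with - 1, so
   the linear terms of the squares cancel. *)
pose f (i : nat) : galg W := D (odd i) (odd i./2) + (-1) ^+ (i < 4)%N.
have f_even i : geven (f i).
  by apply: gevenD => //; case: (_ < _)%N => //=; [apply: gevenN|]; exact: geven1.
have f1 i x : (i < 8)%N -> f i x = 1 \/ f i x = -1.
  move=> _; rewrite /f gaddE -[(-1) ^+ _]mulr1 sgE goneE.
  have [->|x0] := eqVneq x 0; last by rewrite mulr0 addr0; exact: D1.
  by rewrite D0 add0r mulr1; case: (_ < _)%N; [right|left].
have f_aug i : (i < 8)%N -> \sum_x f i x = 1 \/ \sum_x f i x = -1.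
  move=> _; rewrite -/(gaug _) rmorphD /= D_aug add0r rmorph_sign.
  by case: (_ < _)%N; [right|left].
have [] := od8_hadamard f_even f1 f_aug.
  rewrite !big_ord_recl big_ord0 /f /= /bump /=.
  rewrite card_prod natrM natrD.
  transitivity ((D false false ^+ 2 + D false true ^+ 2 + D true false ^+ 2 +
                 D true true ^+ 2) *+ 2 + 8%:R); first by ring.
  by rewrite sum_D_sq natrM; ring.
by rewrite card_prod => M; exists M.
Qed.
End DoubleQuadruple.

(** * Lines of an affine plane *)

(** Signs alternate along an enumeration of A. *)
Lemma sign_sum1 (T : finType) (A : {pred T}) : odd #|A| ->
  exists e : T -> int, [/\ forall x, x \in A -> e x = 1 \/ e x = -1,
    forall x, x \notin A -> e x = 0 & \sum_x e x = 1].
Proof.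
move=> oddA; pose e x : int := if x \in A then (-1) ^+ index x (enum A) else 0.
exists e; split=> [x xA|x /negPf xA|]; rewrite /e ?xA //.
  by rewrite -signr_odd; case: odd; [right|left].
rewrite -big_mkcond /= -big_enum /=.
have /card_gt0P[x0 _] : (0 < #|A|)%N by case: #|A| oddA.
rewrite (big_nth x0) -cardE big_mkord.
rewrite (eq_bigr (fun i : 'I_ _ => (-1) ^+ i)) => [|i _]; last first.
  by rewrite index_uniq ?enum_uniq // -cardE.
rewrite (_ : #|A| = (#|A|./2).*2.+1); last by rewrite -{1}[#|A|]odd_double_half oddA.
elim: (_./2) => [|n IH]; first by rewrite big_ord1.
by rewrite doubleS big_ord_recr big_ord_recr /= IH !exprS -mul2n exprM expr1n.
Qed.

Lemma gmulrzE (G : finZmodType) (f : galg G) z x : (f *~ z) x = f x * z.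
Proof.
by case: z => n; rewrite ?NegzE ?mulrNz ?goppE -pmulrn gmulrnE -mulr_natr natz ?mulrN.
Qed.

Section Lines.
Variable F : finFieldType.
Local Notation V := (F * F)%type.
Local Notation q := #|F|.

(** The projective line [option F] indexes the lines through 0: [Some t] has slope t and [None] is
    vertical. *)
Definition dir (l : option F) : V := if l is Some t then (1, t) else (0, 1).
Definition slope_form (l : option F) (x : V) : F :=
  if l is Some t then x.2 - t * x.1 else x.1.
Definition scale (a : F) (x : V) : V := (a * x.1, a * x.2).
Definition line (l : option F) : galg V := [ffun x => (slope_form l x == 0)%:Z].
Definition line_of (x : V) : option F := if x.1 == 0 then None else Some (x.2 / x.1).

Lemma line_of_scale (x : V) : exists a, x = scale a (dir (line_of x)) /\
  (x != 0 -> a != 0).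
Proof.
case: x => u v; rewrite /line_of /scale /=; case: (eqVneq u 0) => [->|u0] /=.
  exists v; rewrite mulr0 mulr1; split=> //.
  by apply: contraNneq => ->.
by exists u; rewrite mulr1 mulrCA divff // mulr1.
Qed.

Lemma slope_form_scale l a x : slope_form l (scale a x) = a * slope_form l x.
Proof. by case: l => [t|] //=; rewrite mulrBr mulrCA. Qed.

Lemma slope_formB l x y : slope_form l (x - y) = slope_form l x - slope_form l y.
Proof. by case: l => [t|] //=; rewrite mulrBr !opprD opprK addrACA. Qed.

Lemma slope_form_dir l m : (slope_form l (dir m) == 0) = (l == m).
Proof.
case: l m => [t|] [s|] //=; rewrite ?mulr1 ?mulr0 ?subr0 ?oner_eq0 ?eqxx //.
by rewrite subr_eq0 eq_sym.
Qed.

Lemma slope_form_eq0 l x : x != 0 -> (slope_form l x == 0) = (l == line_of x).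
Proof.
have [a [e a0]] := line_of_scale x => /a0 {}a0.
by rewrite {1}e slope_form_scale mulf_eq0 (negPf a0) slope_form_dir.
Qed.

Lemma line_mulE l (f : galg V) x : (line l * f) x = \sum_a f (x - scale a (dir l)).
Proof.
rewrite gmulE.
(* Recovers the parameter a of the point [scale a (dir l)]. *)
pose p (y : V) := if l is Some t then y.1 else y.2.
rewrite (bigID (fun y => slope_form l y == 0)) /= [X in _ + X]big1 => [|y /negPf y0].
  rewrite addr0 (reindex_onto (fun a => scale a (dir l)) p) => [|y].
    apply: eq_big => [a|a]; last by rewrite ffunE => /andP[/eqP-> _]; rewrite eqxx mul1r.
    rewrite slope_form_scale mulf_eq0 slope_form_dir eqxx orbT /=.
    by rewrite /p /scale {p}; case: l => [t|]; rewrite /= mulr1 eqxx.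
  rewrite /p /scale {p}; case: l => [t|] /=; rewrite ?mulr1 ?mulr0.
    by rewrite subr_eq0 => /eqP e; case: y e => u v /= ->; rewrite mulrC.
  by case: y => u v /= /eqP->.
by rewrite ffunE y0 mul0r.
Qed.

Lemma line_even l : geven (line l).
Proof.
by move=> x; rewrite !ffunE -sub0r slope_formB [slope_form l 0](_ : _ = 0) ?sub0r ?oppr_eq0 //;
  case: l => //= t; rewrite mulr0 subrr.
Qed.

(** A line is a subgroup of order q, and the plane is the direct sum of any two distinct lines
    through 0. *)
Lemma line_mul l m : line l * line m = if l == m then line l *+ q else gone.
Proof.
apply/galgP => x; rewrite line_mulE.
under eq_bigr => a _ do rewrite ffunE slope_formB slope_form_scale.
case: (eqVneq l m) => [<-|lm].
  have /eqP d0 : slope_form l (dir l) == 0 by rewrite slope_form_dir.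
  under eq_bigr => a _ do rewrite d0 mulr0 subr0.
  by rewrite sumr_const gmulrnE ffunE.
have d0 : slope_form m (dir l) != 0 by rewrite slope_form_dir eq_sym.
rewrite goneallE (bigD1 (slope_form m x / slope_form m (dir l))) //=.
rewrite big1 ?addr0 => [|a]; first by rewrite divfK ?subrr ?eqxx.
apply: contraNeq; rewrite eqz_nat eqb0 negbK subr_eq0 => /eqP ->.
by rewrite mulfK.
Qed.

Lemma line_value (l : option F) (x : V) : line l x = ((x == 0) || (l == line_of x))%:Z.
Proof.
rewrite ffunE; have [->|x0] := eqVneq x 0; last by rewrite slope_form_eq0.
by case: l => [t|] /=; rewrite ?mulr0 ?subrr eqxx.
Qed.

(** Lines through 0 meet only there, so the coefficients are the values off 0. *)
Definition pencil (e : option F -> int) : galg V := \sum_l line l *~ e l.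

Lemma pencilE e x : pencil e x = if x == 0 then \sum_l e l else e (line_of x).
Proof.
rewrite gsumE; under eq_bigr => l _ do rewrite gmulrzE line_value.
case: (eqVneq x 0) => [->|x0] /=.
  by apply: eq_bigr => l _; rewrite mul1r.
rewrite (bigD1 (line_of x)) //= eqxx mul1r big1 ?addr0 // => l /negPf ->.
by rewrite mul0r.
Qed.

Lemma pencil_even e : geven (pencil e).
Proof. by move=> x; rewrite !gsumE; apply: eq_bigr => l _; rewrite !gmulrzE line_even. Qed.

Lemma pencil_all : pencil (fun=> 1) = q%:R + gone.
Proof.
apply/galgP => x; rewrite pencilE !gE goneallE sumr_const card_option.
by case: (x == 0); rewrite ?mulr1 ?mulr0 ?add0r // natz -addn1 PoszD.
Qed.

(** By [line_mul] each diagonal pair contributes q times its line, and each other pair contributes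
    J. *)
Lemma pencil_mul e e' : pencil e * pencil e' =
  pencil (fun l => e l * e' l) *+ q
  + gone *~ ((\sum_l e l) * (\sum_l e' l) - \sum_l e l * e' l).
Proof.
have -> : pencil e * pencil e' = \sum_l \sum_m (line l * line m) *~ (e l * e' m).
  rewrite big_distrlr /=; apply: eq_bigr => l _; apply: eq_bigr => m _.
  by rewrite mulrzAl mulrzAr -mulrzA [e l * _]mulrC.
transitivity (\sum_l ((line l *+ q) *~ (e l * e' l) +
   (gone *~ (\sum_m e l * e' m) - gone *~ (e l * e' l))) : galg V).
  apply: eq_bigr => l _; rewrite (bigD1 l) //= line_mul eqxx; congr (_ + _).
  rewrite [\sum_m e l * e' m](bigD1 l) //= mulrzDr addrAC subrr add0r.
  rewrite mulrz_sumr; apply: eq_bigr => m /negPf ml.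
  by rewrite line_mul eq_sym ml.
rewrite big_split /= sumrB -!mulrz_sumr mulrzBr; congr (_ + (gone *~ _ - _)).
  rewrite -sumrMnl; apply: eq_bigr => l _; by rewrite !pmulrn -!mulrzA mulrC.
by rewrite big_distrlr.
Qed.

Lemma gaug_line l : gaug (line l) = q%:Z.
Proof.
rewrite /gaug -(mul_goneE _ 0) mulrC line_mulE; under eq_bigr do rewrite goneallE.
by rewrite sumr_const natz.
Qed.

Lemma gaug_pencil e : gaug (pencil e) = (\sum_l e l) * q%:Z.
Proof.
rewrite /pencil raddf_sum big_distrl /=; apply: eq_bigr => l _.
by rewrite raddfMz /= gaug_line -mulrzr intz mulrC.
Qed.

Lemma pencil_sq (A : {pred option F}) e :
  (forall l, l \in A -> e l = 1 \/ e l = -1) -> (forall l, l \notin A -> e l = 0) ->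
  \sum_l e l = 1 ->
  pencil e * pencil e = pencil (fun l => (l \in A)%:Z) *+ q + gone *~ (1 - #|A|%:Z).
Proof.
move=> e1 e0 es; rewrite pencil_mul es mulr1.
have ee l : e l * e l = (l \in A)%:Z.
  by case: (boolP (l \in A)) => [/e1/pm1_sq|/e0->].
have -> : \sum_l e l * e l = #|A|%:Z.
  transitivity (\sum_(l in A) 1 : int); last by rewrite sumr_const natz.
  by rewrite [RHS]big_mkcond; apply: eq_bigr => l _; rewrite ee; case: (l \in A).
by congr (_ *+ _ + _); apply: eq_bigr => l _; rewrite ee.
Qed.

(** P is carried by the lines outside S and R by those in S. Odd cardinalities permit signs of sum
    1, so P and R are 1 at 0, and disjointness makes P R = J. The supports and squares are also
    returned, for the orthogonality relations needed later. *)
Lemma pencil_quadruple (S : {pred option F}) (H K : galg V) :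
  odd #|S| -> odd #|[predC S]| -> geven H -> geven K -> H 0 = 0 -> K 0 = 0 ->
  (forall x, x != 0 -> line_of x \in S -> (H x = 1 \/ H x = -1) /\ K x = 0) ->
  (forall x, x != 0 -> line_of x \notin S -> (K x = 1 \/ K x = -1) /\ H x = 0) ->
  H * H + K * K = #|{: V}|%:R - gone ->
  exists e f : option F -> int,
  [/\ quadruple (pencil e) (pencil f) H K,
      forall l, l \in S -> e l = 0, forall l, l \notin S -> f l = 0,
      pencil e * pencil e =
        pencil (fun l => (l \notin S)%:Z) *+ q + gone *~ (1 - #|[predC S]|%:Z)
    & pencil f * pencil f = pencil (fun l => (l \in S)%:Z) *+ q + gone *~ (1 - #|S|%:Z)].
Proof.
move=> oS oC eH eK H0 K0 HS KS hk.
have [e [e1 e0 es]] := sign_sum1 oC; have [f [f1 f0 fs]] := sign_sum1 oS.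
have ee := pencil_sq e1 e0 es; have ff := pencil_sq f1 f0 fs.
have {}e0 l : l \in S -> e l = 0 by move=> lS; apply: e0; rewrite !inE negbK.
exists e, f; split=> //; split=> //; first by split=> //; exact: pencil_even.
- by rewrite !pencilE eqxx.
- move=> x x0; rewrite !pencilE (negPf x0).
  case: (boolP (line_of x \in S)) => lS; [right|left].
    by have [] := HS x x0 lS; rewrite (e0 _ lS); split=> //; exact: f1.
  by have [] := KS x x0 lS; rewrite (f0 _ lS); split=> //; apply: e1; rewrite !inE.
- have ef0 : \sum_l e l * f l = 0.
    apply: big1 => l _; case: (boolP (l \in S)) => lS; first by rewrite (e0 _ lS) mul0r.
    by rewrite (f0 _ lS) mulr0.
  split=> //; last first.
    rewrite pencil_mul es fs ef0 mulr1 subr0 mulr1z.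
    rewrite [pencil _]big1 ?mul0rn ?add0r // => l _.
    by case: (boolP (l \in S)) => lS; rewrite ?(e0 _ lS) ?(f0 _ lS) ?mul0r ?mulr0 mulr0z.
  rewrite ee ff addrACA -mulrnDl -mulrzDr -big_split /=.
  have -> : \sum_l (line l *~ (l \in [predC S]) + line l *~ (l \in S)) = pencil (fun=> 1).
    by apply: eq_bigr => l _; rewrite !inE -mulrzDr; case: (l \in S).
  have := cardC S; rewrite card_option => cS.
  have -> : 1 - #|[predC S]|%:Z + (1 - #|S|%:Z) = 1 - q%:Z.
    have {cS} : #|S|%:Z + #|[predC S]|%:Z = q%:Z + 1 by rewrite -PoszD cS -addn1 PoszD.
    by move: #|_|%:Z (#|[predC S]|%:Z) => m n; lia.
  rewrite pencil_all card_prod natrM mulrzBr mulr1z mulrnDl -pmulrn -mulr_natr.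
  by rewrite addrACA; ring.
Qed.
End Lines.

(** * Quadratic extension of a finite field *)

(** The field F(sqrt d) on the plane itself, so that lines over F and characters of the field live
    on one group. The parameter d carries the proof that it is not a square, from which the field
    structure is inferred. *)
Definition quad_ext (F : finFieldType) (d : {n : F | [forall b, b * b != n]}) := (F * F)%type.

Section QuadraticExtension.
Variables (F : finFieldType) (d : {n : F | [forall b, b * b != n]}).
Local Notation E := (quad_ext d).
Implicit Types x y z : E.

HB.instance Definition _ := Finite.on E.
HB.instance Definition _ := GRing.Zmodule.on E.

Definition quad_mul x y : E := (x.1 * y.1 + val d * (x.2 * y.2), x.1 * y.2 + x.2 * y.1).
Definition quad_one : E := (1, 0).
Definition quad_norm x : F := x.1 * x.1 - val d * (x.2 * x.2).
Definition quad_inv x : E := (x.1 / quad_norm x, - x.2 / quad_norm x).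

Fact quad_mulA : associative quad_mul.
Proof. by move=> [a b] [a' b'] [a'' b'']; congr pair => /=; ring. Qed.
Fact quad_mulC : commutative quad_mul.
Proof. by move=> [a b] [a' b']; congr pair => /=; ring. Qed.
Fact quad_mul1 : left_id quad_one quad_mul.
Proof. by move=> [a b]; congr pair => /=; ring. Qed.
Fact quad_mulD : left_distributive quad_mul +%R.
Proof. by move=> [a b] [a' b'] [a'' b'']; congr pair => /=; ring. Qed.
Fact quad_one_neq0 : quad_one != 0.
Proof. by rewrite xpair_eqE oner_eq0. Qed.

HB.instance Definition _ := GRing.Zmodule_isComNzRing.Build E
  quad_mulA quad_mulC quad_mul1 quad_mulD quad_one_neq0.

(** A zero a^2 = d b^2 with b != 0 would make a / b a square root of d. *)
Lemma quad_norm_neq0 x : x != 0 -> quad_norm x != 0.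
Proof.
case: x => a b; rewrite /quad_norm /= => ab0; apply/eqP => /eqP.
rewrite subr_eq0 => /eqP e; case: (eqVneq b 0) ab0 e => [->|b0] ab0 e.
  move: ab0; rewrite xpair_eqE eqxx andbT.
  by move/eqP: e; rewrite !mulr0 mulf_eq0 orbb => ->.
have /forallP/(_ (a / b))/eqP := valP d; apply.
by rewrite mulrACA -invfM e mulfK // mulf_neq0.
Qed.

Fact quad_mulV x : x != 0 -> quad_mul (quad_inv x) x = quad_one.
Proof.
move=> /quad_norm_neq0 N0; case: x N0 => a b; rewrite /quad_inv /quad_mul /= => N0.
by congr pair; move: N0; rewrite /quad_norm /= => N0; field.
Qed.

Fact quad_inv0 : quad_inv 0 = 0.
Proof. by rewrite /quad_inv /= oppr0 !mul0r. Qed.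

HB.instance Definition _ := GRing.ComNzRing_isField.Build E quad_mulV quad_inv0.

Lemma card_quad_ext : #|{: E}| = (#|F| ^ 2)%N.
Proof. by rewrite card_prod. Qed.

Definition quad_of (a : F) : E := (a, 0).

Lemma quad_ofX a n : quad_of a ^+ n = quad_of (a ^+ n).
Proof.
elim: n => [|n IH] //; rewrite !exprS IH.
by congr pair; rewrite /= ?mulr0 ?mul0r ?addr0.
Qed.

Lemma quad_of_mul a x : quad_of a * x = scale a x.
Proof. by case: x => u v; congr pair; rewrite /= !mul0r ?mulr0 ?addr0. Qed.
End QuadraticExtension.

Lemma quad_ext_ex (F : finFieldType) : odd #|F| -> exists n : F, [forall b, b * b != n].
Proof.
move=> oF; have [nu e] := nonresidue_ex oF; exists nu; apply/forallP => b.
apply/eqP => bb; have nu0 := nonresidue_neq0 oF e.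
have b0 : b != 0 by apply: contraNneq nu0 => b0; rewrite -bb b0 mul0r.
move: e; rewrite -bb /qpow exprMn -expr2 -/(qpow b) qpow_sq // => /esym/eqP.
by rewrite (negPf (opp1_neq1 oF)).
Qed.

Section QuadraticCharacterOnLines.
Variables (F : finFieldType) (d : {n : F | [forall b, b * b != n]}).
Hypothesis F_odd : odd #|F|.
Local Notation E := (quad_ext d).

Lemma odd_quad_ext : odd #|{: E}|.
Proof. by rewrite card_quad_ext oddX F_odd. Qed.

(** (q^2 - 1)/2 is a multiple of q - 1, so nonzero elements of F are squares in the extension, and
    the character is constant on each line through 0 without its origin. *)
Lemma qchar_quad_of (a : F) : a != 0 -> qchar (quad_of d a) = 1.
Proof.
move=> a0; rewrite /qchar /qpow quad_ofX card_quad_ext.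
have -> : ((#|F| ^ 2).-1./2 = #|F|.-1 * (#|F|.+1)./2)%N.
  by have := F_odd; case: #|F| => // n /= /negbTE on; nia.
by rewrite exprM expf_card_pred // expr1n eqxx xpair_eqE (negPf a0).
Qed.

Lemma qchar_line (x : F * F) : x != 0 -> qchar (x : E) = qchar (dir (line_of x) : E).
Proof.
have [a [e a0]] := line_of_scale x => /a0 {}a0.
by rewrite {1}e -(@quad_of_mul _ d) qcharM ?odd_quad_ext // qchar_quad_of // mul1r.
Qed.

(** The pencil with these coefficients, less their sum at 0, is the quadratic character; its
    augmentation, q - 1 times the sum, vanishes. *)
Lemma sum_qchar_dir : \sum_l qchar (dir l : E) = 0.
Proof.
pose e l := qchar (dir l : E).
have : gaug (pencil e - (\sum_l e l)%:~R : galg (F * F)%type) = 0.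
  rewrite -[RHS](gqchar_sum odd_quad_ext) /gaug; apply: eq_bigr => x _.
  rewrite !gE gmulrzE goneE pencilE ffunE; have [->|x0] := eqVneq x 0.
    by rewrite mul1r subrr qchar0.
  by rewrite mul0r subr0 qchar_line.
rewrite rmorphB rmorph_int /= gaug_pencil intz => /eqP.
rewrite -[X in _ - X]mulr1 -mulrBr mulf_eq0 subr_eq0 => /orP[/eqP//|].
by rewrite eqz_nat => /eqP q1; have := card_finNzRing_gt1 F; rewrite q1.
Qed.

Lemma card_qchar_dir :
  #|[pred l | qchar (dir l : E) == 1]| = #|[predC [pred l | qchar (dir l : E) == 1]]|.
Proof.
have := sum_qchar_dir; rewrite (bigID [pred l | qchar (dir l : E) == 1]) /=.
rewrite (eq_bigr (fun=> 1)) => [|l /eqP//]; rewrite [X in _ + X](eq_bigr (fun=> -1)).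
  by rewrite !sumr_const mulNrn !natz => /eqP; rewrite subr_eq0 eqz_nat => /eqP.
move=> l l1; have : dir l != 0 :> E by case: l l1 => [t|] _; rewrite xpair_eqE oner_eq0 ?andbF.
by move/(qchar_pm1) => [e|//]; rewrite e eqxx in l1.
Qed.
End QuadraticCharacterOnLines.

(** * The quartic character and squares of prime powers congruent to 1 mod 4 *)

Section QuarticCharacter.
Variable E : finFieldType.
Hypothesis E8 : (#|E| %% 8 = 1)%N.

Let E_odd : odd #|E|. Proof. by lia. Qed.

Definition rpow (x : E) := x ^+ (#|E|.-1 %/ 4).

Let rpow_sq x : rpow x ^+ 2 = qpow x.
Proof. by rewrite /rpow /qpow -exprM; congr (_ ^+ _); lia. Qed.

Let rpowM x y : rpow (x * y) = rpow x * rpow y. Proof. exact: exprMn. Qed.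

Variable i : E.
Hypothesis i2 : i * i = -1.

(** [rpow] maps nonzero elements to the fourth roots of unity of E; sending i to a complex root of
    -1 gives the quartic character, split here into real and imaginary parts. *)
Definition quartic_re (x : E) : int := (rpow x == 1)%:Z - (rpow x == -1)%:Z.
Definition quartic_im (x : E) : int := (rpow x == i)%:Z - (rpow x == - i)%:Z.

Let N11 : (-1 == 1 :> E) = false. Proof. exact/negbTE/opp1_neq1. Qed.
Let i0 : i != 0.
Proof. by apply/eqP => i0; move/eqP: i2; rewrite i0 mul0r eq_sym oppr_eq0 oner_eq0. Qed.
Let i1 : (i == 1) = false.
Proof. by apply/eqP => e; move/eqP: i2; rewrite e mulr1 eq_sym N11. Qed.
Let iN1 : (i == -1) = false.
Proof. by apply/eqP => e; move/eqP: i2; rewrite e mulrNN mulr1 eq_sym N11. Qed.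
Let iNi : (i == - i) = false.
Proof.
by rewrite -subr_eq0 opprK -mulr2n -mulr_natl mulf_eq0 (negPf i0) (negPf (two_neq0 _)).
Qed.

Let rpow_cases x : x != 0 -> [\/ rpow x = 1, rpow x = -1, rpow x = i | rpow x = - i].
Proof.
move=> x0; have := rpow_sq x; case: (qpow_pm1 E_odd x0) => ->; first move/eqP.
  by rewrite sqrf_eq1 => /orP[]/eqP ->; [constructor 1|constructor 2].
by rewrite -i2 -expr2 => /eqP; rewrite eqf_sqr => /orP[]/eqP ->; [constructor 3|constructor 4].
Qed.

Let rpow0 : rpow 0 = 0.
Proof.
rewrite /rpow expr0n; case: eqP => // e; exfalso.
by have : (1 < #|E|)%N := card_finNzRing_gt1 E; lia.
Qed.

Let v1 : (1 == i) = false. Proof. by rewrite eq_sym. Qed.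
Let v2 : (1 == - i) = false. Proof. by rewrite eq_sym eqr_oppLR. Qed.
Let v3 : (1 == -1 :> E) = false. Proof. by rewrite eq_sym. Qed.
Let v4 : (-1 == i) = false. Proof. by rewrite eq_sym. Qed.
Let v5 : (-1 == - i) = false. Proof. by rewrite eqr_opp eq_sym. Qed.
Let v6 : (- i == 1) = false. Proof. by rewrite eq_sym. Qed.
Let v7 : (- i == -1) = false. Proof. by rewrite eqr_opp. Qed.
Let v8 : (- i == i) = false. Proof. by rewrite eq_sym. Qed.
Let V := (v1, v2, v3, v4, v5, v6, v7, v8, N11, i1, iN1, iNi, eqxx).

(** Real part of conj(chi(y)) chi(z) = chi(z / y). *)
Lemma quartic_ratio y z : y != 0 ->
  quartic_re y * quartic_re z + quartic_im y * quartic_im z = quartic_re (z / y).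
Proof.
move=> y0; have [->|z0] := eqVneq z 0.
  have e0 : (0 == i) = false by rewrite eq_sym (negPf i0).
  have e0' : (0 == - i) = false by rewrite eq_sym oppr_eq0 (negPf i0).
  have e1 : (0 == -1 :> E) = false by rewrite eq_sym oppr_eq0 oner_eq0.
  have e2 : (0 == 1 :> E) = false by rewrite eq_sym oner_eq0.
  by rewrite mul0r /quartic_re /quartic_im rpow0 e0 e0' e1 e2 !mulr0.
have e : rpow z = rpow (z / y) * rpow y by rewrite -rpowM divfK.
have zy0 : z / y != 0 by rewrite mulf_neq0 ?invr_neq0.
rewrite /quartic_re /quartic_im e.
by case: (rpow_cases zy0) => ->; case: (rpow_cases y0) => ->;
  rewrite ?mul1r ?mulr1 ?mulN1r ?mulrN1 ?mulNr ?mulrN ?i2 ?opprK !V.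
Qed.

Let rpowN1 : rpow (-1) = 1.
Proof.
have e : odd (#|E|.-1 %/ 4) = false.
  by rewrite (divn_eq #|E| 8) E8 addn1 /= -[8%N]/(2 * 4)%N mulnA mulnK // oddM andbF.
by rewrite /rpow -signr_odd e expr0.
Qed.

Lemma quartic_square x : qpow x = 1 ->
  (quartic_re x = 1 \/ quartic_re x = -1) /\ quartic_im x = 0.
Proof.
rewrite -rpow_sq /quartic_re /quartic_im => /eqP.
by rewrite sqrf_eq1 => /orP[]/eqP ->; rewrite !V; split=> //; [left|right].
Qed.

Lemma quartic_nonsquare x : qpow x = -1 ->
  (quartic_im x = 1 \/ quartic_im x = -1) /\ quartic_re x = 0.
Proof.
rewrite -rpow_sq -i2 -expr2 /quartic_re /quartic_im => /eqP.
by rewrite eqf_sqr => /orP[]/eqP ->; rewrite !V; split=> //; [left|right].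
Qed.

Lemma quartic_re0 : quartic_re 0 = 0.
Proof. by rewrite /quartic_re rpow0 ![0 == _]eq_sym oppr_eq0 oner_eq0. Qed.

Lemma quartic_im0 : quartic_im 0 = 0.
Proof. by rewrite /quartic_im rpow0 ![0 == _]eq_sym oppr_eq0 (negPf i0). Qed.

Lemma quartic_even x : quartic_re (- x) = quartic_re x /\ quartic_im (- x) = quartic_im x.
Proof. by rewrite /quartic_re /quartic_im -[- x]mulN1r rpowM rpowN1 mul1r. Qed.

(** Multiplication by the square of a nonresidue changes the sign of the character. *)
Lemma sum_quartic_re : \sum_x quartic_re x = 0.
Proof.
have [nu e] := nonresidue_ex E_odd.
have nu2 : nu * nu != 0 by rewrite mulf_neq0 // (nonresidue_neq0 E_odd).
have re : rpow (nu * nu) = -1 by rewrite rpowM -expr2 rpow_sq.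
have : \sum_x quartic_re x = - \sum_x quartic_re x.
  rewrite {1}(reindex_inj (mulfI nu2)) -sumrN; apply: eq_bigr => x _.
  by rewrite /quartic_re rpowM re mulN1r eqr_oppLR eqr_opp opprB.
by move/eqP; rewrite -addr_eq0 -mulr2n mulrn_eq0 => /eqP.
Qed.

Lemma quartic_norm :
  let H : galg E := [ffun x => quartic_re x] in let K : galg E := [ffun x => quartic_im x] in
  H * H + K * K = #|E|%:R - gone.
Proof.
move=> H K; apply/galgP => x; rewrite gaddE !gmulE -big_split !gE goneallE /=.
under eq_bigr => y _ do rewrite !ffunE.
rewrite (@sum_ratio _ (fun y z => quartic_re y * quartic_re z + quartic_im y * quartic_im z)
  quartic_re) => [|z|y z|].
- by rewrite (_ : quartic_re (-1) = 1) ?mul1r // /quartic_re rpowN1 !V.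
- by rewrite quartic_re0 quartic_im0 !mul0r.
- exact: quartic_ratio.
- exact: sum_quartic_re.
Qed.
End QuarticCharacter.

Lemma sqrtN1_ex (E : finFieldType) : (#|E| %% 8 = 1)%N -> exists i : E, i * i = -1.
Proof.
move=> E8; have [nu e] := @nonresidue_ex E ltac:(lia).
exists (rpow nu); rewrite -expr2 -e /rpow /qpow -exprM; congr (_ ^+ _); lia.
Qed.

(** The quartic character is real on squares and imaginary on nonsquares, which are unions of lines
    up to 0. Each kind has (q + 1)/2 lines, an odd number for q = 1 mod 4. *)
Theorem quadruple_prime_power_sq (F : finFieldType) : (#|F| %% 4 = 1)%N ->
  exists (G : finZmodType) (P R H K c : galg G),
  [/\ #|G| = (#|F| ^ 2)%N, quadruple P R H K & conference_core c].
Proof.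
move=> F4; have F_odd : odd #|F| by lia.
have [n nP] := quad_ext_ex F_odd; pose d := exist _ n nP : {n : F | [forall b, b * b != n]}.
pose E : finFieldType := quad_ext d.
have cE : #|E| = (#|F| ^ 2)%N by exact: card_quad_ext.
have E8 : (#|E| %% 8 = 1)%N.
  by rewrite cE (divn_eq #|F| 4) F4 sqrnD -modnDm; lia.
have [i i2] := sqrtN1_ex E8.
have E_odd : odd #|E| by lia.
pose H : galg (F * F)%type := [ffun x => quartic_re (x : E)].
pose K : galg (F * F)%type := [ffun x => quartic_im i (x : E)].
pose S := [pred l | qchar (dir l : E) == 1].
have cS : #|S| = #|[predC S]| by exact: card_qchar_dir.
have oS : odd #|S|.
  have := cardC S; rewrite card_option -cS addnn => /(congr1 half); rewrite doubleK => ->.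
  by clear -F4; set m := #|F| in F4 *; lia.
have q1 (x : F * F) : x != 0 -> line_of x \in S -> qpow (x : E) = 1.
  move=> x0; rewrite inE -qchar_line // /qchar (negPf (x0 : (x : E) != 0)).
  by have [->|->] := qpow_pm1 E_odd (x0 : (x : E) != 0); rewrite ?(negPf (opp1_neq1 E_odd)).
have q2 (x : F * F) : x != 0 -> line_of x \notin S -> qpow (x : E) = -1.
  move=> x0; rewrite inE -qchar_line // /qchar (negPf (x0 : (x : E) != 0)).
  by have [->|->] := qpow_pm1 E_odd (x0 : (x : E) != 0); rewrite ?eqxx.
have [|||||||||e [f [Q _ _ _ _]]] := @pencil_quadruple F S H K.
- exact: oS.
- by rewrite -cS.
- by move=> x; rewrite !ffunE; case: (quartic_even E8 i (x : E)).
- by move=> x; rewrite !ffunE; case: (quartic_even E8 i (x : E)).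
- by rewrite ffunE; exact: (quartic_re0 E8 i2).
- by rewrite ffunE; exact: (quartic_im0 E8 i2).
- by move=> x x0 /(q1 x x0) /(quartic_square E8 i2); rewrite !ffunE.
- by move=> x x0 /(q2 x x0) /(quartic_nonsquare E8 i2); rewrite !ffunE.
- exact: (quartic_norm E8 i2).
have E4 : (#|E| %% 4 = 1)%N by clear -E8; set m := #|E| in E8 *; lia.
have ce : geven (gqchar E) := gqchar_even E_odd E4.
exists (F * F)%type, (pencil e), (pencil f), H, K, (gqchar E); split=> //.
split=> //; first by rewrite ffunE qchar0.
- by move=> x x0; rewrite ffunE; exact: (@qchar_pm1 E).
- have := gqchar_star E_odd; rewrite gstar_even //; exact.
Qed.

(** * Orthogonal quadruples and their products *)

(* For each nontrivial character exactly one of P + H, P - H, R + K, R - K is nonzero. *)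
Definition orthogonal_quadruple (G : finZmodType) (P R H K : galg G) : Prop :=
  quadruple P R H K /\ [/\ P * P = H * H + gone, P * K = 0, R * H = 0 & H * K = 0].

(** H K = 0 gives (H + K)^2 = H^2 + K^2, and the supports of H and K partition the nonzero
    elements. *)
Lemma orthogonal_core (G : finZmodType) (P R H K : galg G) :
  orthogonal_quadruple P R H K -> conference_core (H + K).
Proof.
move=> [[[_ _ eH eK] [_ _ H0 K0] q [_ _ hk]] [_ _ _ hk0]]; split.
- exact: gevenD.
- by rewrite gE H0 K0.
- by move=> x /q [[_ k1 _ h]|[_ h1 _ k]]; rewrite gE ?h ?k ?add0r ?addr0.
- by rewrite -hk mulrDl !mulrDr [K * H]mulrC hk0 addr0 add0r.
Qed.

Section Product.
Variables (G1 G2 : finZmodType) (P R H K : galg G1) (p r h k : galg G2).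
Hypothesis Q1 : orthogonal_quadruple P R H K.
Hypothesis Q2 : orthogonal_quadruple p r h k.
Local Notation W := (G1 * G2)%type.
Local Notation i1 := (@ginl G1 G2).
Local Notation i2 := (@ginr G1 G2).

(* Turyn's composition, multiplied by 2. *)
Let EP : galg W := i1 (P + K) * i2 (p + h) + i1 (P - K) * i2 (r + k).
Let EH : galg W := i1 (H + R) * i2 (p + h) + i1 (H - R) * i2 (r + k).
Let ER : galg W := i1 (H + R) * i2 (p - h) + i1 (R - H) * i2 (r - k).
Let EK : galg W := i1 (P + K) * i2 (p - h) - i1 (P - K) * i2 (r - k).

Let E_val z : if z == 0 then [/\ EP z = 2, ER z = 2, EH z = 0 & EK z = 0] else
  [/\ EP z = 2 \/ EP z = -2, EK z = 2 \/ EK z = -2, ER z = 0 & EH z = 0] \/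
  [/\ ER z = 2 \/ ER z = -2, EH z = 2 \/ EH z = -2, EP z = 0 & EK z = 0].
Proof.
have [[_ [P0 R0 H0 K0] q1 _] _] := Q1; have [[_ [p0 r0 h0 k0] q2 _] _] := Q2.
case: z => x y; rewrite /EP /ER /EH /EK !gaddE !goppE !ginlrE /= !gaddE !goppE xpair_eqE.
have [->|/q1 {}q1] := eqVneq x 0; have [->|/q2 {}q2] := eqVneq y 0;
  rewrite ?P0 ?R0 ?H0 ?K0 ?p0 ?r0 ?h0 ?k0 /=.
- by [].
- by case: q2 => -[[->|->] [->|->] -> ->];
    (left; split; by [|left|right]) || (right; split; by [|left|right]).
- by case: q1 => -[[->|->] [->|->] -> ->];
    (left; split; by [|left|right]) || (right; split; by [|left|right]).
- by case: q1 => -[[->|->] [->|->] -> ->]; case: q2 => -[[->|->] [->|->] -> ->];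
    (left; split; by [|left|right]) || (right; split; by [|left|right]).
Qed.

Let half (f : galg W) : galg W := [ffun z => (f z %/ 2)%Z].

Let P' := half EP. Let R' := half ER. Let H' := half EH. Let K' := half EK.

Let half2 : [/\ P' *+ 2 = EP, R' *+ 2 = ER, H' *+ 2 = EH & K' *+ 2 = EK].
Proof.
split; apply/galgP => z; rewrite gmulrnE ffunE; have := E_val z; case: ifP => _;
  by [case=> e1 e2 e3 e4; rewrite ?e1 ?e2 ?e3 ?e4 | case=> -[[e1|e1] [e2|e2] e3 e4];
      rewrite ?e1 ?e2 ?e3 ?e4].
Qed.

Let half_even f : geven f -> geven (half f).
Proof. by move=> ef z; rewrite [LHS]ffunE ef [RHS]ffunE. Qed.

Lemma orthogonal_product : exists P R H K : galg W, orthogonal_quadruple P R H K.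
Proof.
exists P', R', H', K'.
have [P2 R2 H2 K2] := half2.
have [[[eP eR eH eK] _ _ [a1 a2 a3]] [a4 a5 a6 a7]] := Q1.
have [[[ep er eh ek] _ _ [b1 b2 b3]] [b4 b5 b6 b7]] := Q2.
have r1 : i1 P * i1 P + i1 K * i1 K = #|G1|%:R.
  by rewrite -!rmorphM -(rmorph_nat i1) -rmorphD a4 addrAC a3 subrK.
have r2 : i1 H * i1 H + i1 R * i1 R = #|G1|%:R.
  rewrite -!rmorphM -(rmorph_nat i1) -rmorphD; congr (i1 _); apply: (addrI gone).
  by rewrite addrA [gone + _]addrC -a4 a1 addrC.
have r3 : i1 P * i1 P = i1 H * i1 H + i1 gone by rewrite -!rmorphM -rmorphD a4.
have r4 : i1 P * i1 R = i1 gone by rewrite -rmorphM a2.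
have r5 : i1 P * i1 K = 0 by rewrite -rmorphM a5 rmorph0.
have r6 : i1 R * i1 H = 0 by rewrite -rmorphM a6 rmorph0.
have r7 : i1 H * i1 K = 0 by rewrite -rmorphM a7 rmorph0.
have s1 : i2 p * i2 p + i2 k * i2 k = #|G2|%:R.
  by rewrite -!rmorphM -(rmorph_nat i2) -rmorphD b4 addrAC b3 subrK.
have s2 : i2 h * i2 h + i2 r * i2 r = #|G2|%:R.
  rewrite -!rmorphM -(rmorph_nat i2) -rmorphD; congr (i2 _); apply: (addrI gone).
  by rewrite addrA [gone + _]addrC -b4 b1 addrC.
have s3 : i2 p * i2 p = i2 h * i2 h + i2 gone by rewrite -!rmorphM -rmorphD b4.
have s4 : i2 p * i2 r = i2 gone by rewrite -rmorphM b2.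
have s5 : i2 p * i2 k = 0 by rewrite -rmorphM b5 rmorph0.
have s6 : i2 r * i2 h = 0 by rewrite -rmorphM b6 rmorph0.
have s7 : i2 h * i2 k = 0 by rewrite -rmorphM b7 rmorph0.
have cancel (f g : galg W) : f *+ 4 = g *+ 4 -> f = g by exact: gmulrnI.
have mul2 (f g : galg W) : (f * g) *+ 4 = (f *+ 2) * (g *+ 2) by ring.
have evE : [/\ geven EP, geven ER, geven EH & geven EK].
  by split; do ?[apply: gevenD | apply: gevenN | apply: gevenM
       | apply: geven_inl | apply: geven_inr].
have [? ? ? ?] := evE.
(* Separates the factors from the two groups, to which the relations apply. *)
have mulD4 (x y z w s t s' t' : galg W) : (x * s + y * t) * (z * s' + w * t') =
    (x * z) * (s * s') + (x * w) * (s * t') + (y * z) * (t * s') + (y * w) * (t * t').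
  by ring.
have X : [/\ [/\ EP * EP = EH * EH + gone *+ 4, EP * EK = 0, ER * EH = 0 & EH * EK = 0],
   EP * EP + ER * ER = (#|{: W}|%:R + gone) *+ 4, EP * ER = gone *+ 4
   & EH * EH + EK * EK = (#|{: W}|%:R - gone) *+ 4].
  rewrite /EP /EK /EH /ER gone_pair !(rmorphD, rmorphN) /= card_prod natrM -!mulNr !mulD4.
  move: {a1 a2 a3 a4 a5 a6 a7 b1 b2 b3 b4 b5 b6 b7} r1 r2 r3 r4 r5 r6 r7 s1 s2 s3 s4 s5 s6 s7.
  move: (i1 P) (i1 R) (i1 H) (i1 K) (i1 gone) (i2 p) (i2 r) (i2 h) (i2 k) (i2 gone).
  move=> A B C D J a b c d j r1 r2 r3 r4 r5 r6 r7 s1 s2 s3 s4 s5 s6 s7.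
  (* As p k = r h = h k = 0, all four products of p +- h with r +- k equal p r = J. *)
  have lin (e f : bool) : (a + (-1) ^+ e * c) * (b + (-1) ^+ f * d) = j.
    transitivity (a * b + (-1) ^+ f * (a * d) + (-1) ^+ e * (b * c) +
      (-1) ^+ (e + f) * (c * d)); first by rewrite exprD; ring.
    by rewrite s4 s5 s6 s7; ring.
  have t1 : (a + c) * (b + d) = j by rewrite -(lin false false) !mul1r.
  have t2 : (a + c) * (b - d) = j by rewrite -(lin false true) mul1r mulN1r.
  have t3 : (a - c) * (b + d) = j by rewrite -(lin true false) mul1r mulN1r.
  have t4 : (a - c) * (b - d) = j by rewrite -(lin true true) !mulN1r.
  have t5 : (a + c) * (a - c) = j.
    by transitivity (a * a - c * c); [ring | rewrite s3; ring].
  have t6 : (b + d) * (b - d) = j.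
    transitivity ((c * c + b * b) - (a * a + d * d) + (a * a - c * c)); first by ring.
    by rewrite s1 s2 s3; ring.
  have t7 : (b - d) * (b - d) = #|G2|%:R *+ 4 - (a + c) * (a + c) - (a - c) * (a - c)
    - (b + d) * (b + d) by rewrite -[_ *+ 4]/(_ *+ (2 + 2)) mulrnDr -{1}s1 -s2; ring.
  (* Likewise P K = R H = 0 makes P +- K and H +- R square to the group order. *)
  have u1 : (A + D) * (A + D) = #|G1|%:R.
    by transitivity (A * A + D * D + (A * D) *+ 2); [ring | rewrite r1 r5; ring].
  have u2 : (A - D) * (A - D) = #|G1|%:R.
    by transitivity (A * A + D * D - (A * D) *+ 2); [ring | rewrite r1 r5; ring].
  have u3 : (C + B) * (C + B) = #|G1|%:R.
    by transitivity (C * C + B * B + (B * C) *+ 2); [ring | rewrite r2 r6; ring].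
  have u4 : (C - B) * (C - B) = #|G1|%:R.
    by transitivity (C * C + B * B - (B * C) *+ 2); [ring | rewrite r2 r6; ring].
  have u5 : (A + D) * (A - D) = (C + B) * (C - B) + J *+ 2.
    transitivity ((C + B) * (C - B) + (A * A - C * C) *+ 2 + (C * C + B * B) - (A * A + D * D));
      first by ring.
    by rewrite r1 r2 r3; ring.
  have u6 : ((A + D) + (A - D)) * ((C + B) - (C - B)) = J *+ 4.
    by transitivity ((A * B) *+ 4); [ring | rewrite r4].
  have u7 : ((C + B) + (C - B)) * ((A + D) - (A - D)) = 0.
    by transitivity ((C * D) *+ 4); [ring | rewrite r7 mul0rn].
  have u8 : B - C = - (C - B) by rewrite opprB.
  rewrite !u8 ?(mulNr, mulrN, opprK).
  (* The sums become variables: from here only the products computed above matter. *)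
  move: (A + D) (A - D) (C + B) (C - B) (a + c) (a - c) (b + d) (b - d)
    u1 u2 u3 u4 u5 u6 u7 t1 t2 t3 t4 t5 t6 t7.
  move=> x y z w s s' t t' u1 u2 u3 u4 u5 u6 u7 t1 t2 t3 t4 t5 t6 t7.
  rewrite ![s' * s]mulrC ![t * s]mulrC ![t * s']mulrC ![t' * s]mulrC ![t' * t]mulrC ![t' * s']mulrC
    ?t1 ?t2 ?t3 ?t4 ?t5 ?t6 ?t7 ?u1 ?u2 ?u3 ?u4.
  split; first split.
  - by rewrite ![y * x]mulrC u5; ring.
  - by ring.
  - by ring.
  - by transitivity ((z + w) * (x - y) * j); [ring | rewrite u7 mul0r].
  - by rewrite ![y * x]mulrC u5; ring.
  - by transitivity ((x + y) * (z - w) * j); [ring | rewrite u6 mulrnAl].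
  - by rewrite ![y * x]mulrC u5; ring.
have [[x1 x2 x3 x4] x5 x6 x7] := X.
split; last first.
  by split; apply: cancel; rewrite ?mulrnDl !mul2 ?P2 ?R2 ?H2 ?K2 ?mul0rn.
split; first by split; apply: half_even.
- have := E_val 0; rewrite eqxx => -[e1 e2 e3 e4].
  by split; rewrite ffunE ?e1 ?e2 ?e3 ?e4.
- move=> z z0; have := E_val z; rewrite (negPf z0).
  have halfE (f : galg W) (m : int) : f z = m -> half f z = (m %/ 2)%Z by rewrite ffunE => ->.
  rewrite /P' /R' /H' /K'; by case=> -[[/halfE->|/halfE->] [/halfE->|/halfE->] /halfE-> /halfE->];
    [left|left|left|left|right|right|right|right]; split; by [|left|right].
- by split; apply: cancel; rewrite -?x5 -?x6 -?x7 ?mulrnDl ?mul2 ?P2 ?R2 ?H2 ?K2.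
Qed.
End Product.

Lemma orthogonal_quadruple_one :
  exists P R H K : galg 'I_1, orthogonal_quadruple P R H K.
Proof.
have g1 : (gone : galg 'I_1) = 1 by apply/galgP => x; rewrite !ffunE ord1.
exists 1, 1, 0, 0; rewrite /orthogonal_quadruple /quadruple g1 card_ord.
rewrite !(mulr0, mul0r, mulr1, addr0, add0r) subrr; split; split=> //.
- by split=> // x; rewrite ?(gzeroE, goneE) ?oppr_eq0.
- by rewrite goneE gzeroE.
- by move=> x; rewrite ord1 eqxx.
Qed.

(** The four lines a, b, c, d through 0 satisfy a + b + c + d = 3 + J; take P = 3 - c - d, R = 3 - a
    - b, H = a - b, K = c - d. *)
Lemma orthogonal_quadruple_nine :
  exists P R H K : galg ('F_3 * 'F_3)%type, orthogonal_quadruple P R H K.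
Proof.
have c3 : #|'F_3| = 3%N by rewrite card_Fp.
pose L := @line 'F_3.
have sq l : L l * L l = L l *+ 3 by rewrite /L line_mul eqxx c3.
have orth l m : l != m -> L l * L m = gone by rewrite /L line_mul => /negPf->.
have val l x : L l x = ((x == 0) || (l == line_of x))%:Z by exact: line_value.
have ev l : geven (L l) by exact: line_even.
have cases3 (t : 'F_3) : [\/ t = 0, t = 1 | t = -1].
  by case: t => -[|[|[|//]]] ?; [constructor 1|constructor 2|constructor 3]; apply: val_inj.
(* Each line is abstracted to a variable known only by its values and products, giving [ring]
   atoms. *)
have [a [ea va saa ab [ac ad]]] : exists a, [/\ geven a,
    forall x, a x = ((x == 0) || (None == line_of x))%:Z, a * a = a *+ 3,
    a * L (Some 0) = gone & a * L (Some 1) = gone /\ a * L (Some (-1)) = gone].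
  by exists (L None); rewrite sq !orth.
have [b [eb vb sbb bc [bd {}ab]]] : exists b, [/\ geven b,
    forall x, b x = ((x == 0) || (Some 0 == line_of x))%:Z, b * b = b *+ 3,
    b * L (Some 1) = gone & b * L (Some (-1)) = gone /\ a * b = gone].
  by exists (L (Some 0)); rewrite sq !orth.
have [c [ec vc scc cd [{}ac {}bc]]] : exists c, [/\ geven c,
    forall x, c x = ((x == 0) || (Some 1 == line_of x))%:Z, c * c = c *+ 3,
    c * L (Some (-1)) = gone & a * c = gone /\ b * c = gone].
  by exists (L (Some 1)); rewrite sq !orth.
have [d [ed vd sdd {}cd [{}ad {}bd]]] : exists d, [/\ geven d,
    forall x, d x = ((x == 0) || (Some (-1) == line_of x))%:Z, d * d = d *+ 3,
    c * d = gone & a * d = gone /\ b * d = gone].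
  by exists (L (Some (-1))); rewrite sq.
have [w [w3 vw]] : exists w : galg ('F_3 * 'F_3)%type,
  w = 3%:R /\ forall x, w x = 3 * (x == 0)%:Z.
  by exists 3%:R; split=> // x; exact: gnatE.
have d_eq : d = w + gone - a - b - c.
  apply/galgP => x; rewrite !(gaddE, goppE) vw goneallE va vb vc vd.
  case: (x == 0) => //=; case: (line_of x) => [t|] //.
  by case: (cases3 t) => ->.
have card9 : #|{: 'F_3 * 'F_3}|%:R = 9%:R :> galg ('F_3 * 'F_3)%type.
  by rewrite card_prod c3.
have ew : geven w by move=> x; rewrite !vw oppr_eq0.
exists (w - c - d), (w - a - b), (a - b), (c - d).
clear L sq orth val ev c3.
have PP : (3%:R - c - d) * (3%:R - c - d) = 9%:R - c *+ 3 - d *+ 3 + gone *+ 2.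
  transitivity (9%:R - c *+ 6 - d *+ 6 + c * c + d * d + (c * d) *+ 2); first by ring.
  by rewrite scc sdd cd; ring.
have RR : (3%:R - a - b) * (3%:R - a - b) = 9%:R - a *+ 3 - b *+ 3 + gone *+ 2.
  transitivity (9%:R - a *+ 6 - b *+ 6 + a * a + b * b + (a * b) *+ 2); first by ring.
  by rewrite saa sbb ab; ring.
have HH : (a - b) * (a - b) = a *+ 3 + b *+ 3 - gone *+ 2.
  by transitivity (a * a + b * b - (a * b) *+ 2); [ring | rewrite saa sbb ab; ring].
have KK : (c - d) * (c - d) = c *+ 3 + d *+ 3 - gone *+ 2.
  by transitivity (c * c + d * d - (c * d) *+ 2); [ring | rewrite scc sdd cd; ring].
split; first split.
- by split; do ?[assumption | apply: gevenD | apply: gevenN].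
- by rewrite !(gaddE, goppE) !vw va vb vc vd eqxx.
- move=> x x0; rewrite !(gaddE, goppE) !vw va vb vc vd (negPf x0) /=.
  case: (line_of x) => [t|]; last by right; split=> //; by [left|right].
  by case: (cases3 t) => ->; [right|left|left]; split=> //; by [left|right].
- rewrite card9; rewrite w3 in d_eq *; split; first by rewrite PP RR d_eq; ring.
    transitivity (9%:R - (a + b + c + d) *+ 3 + a * c + b * c + a * d + b * d); first by ring.
    by rewrite ac bc ad bd d_eq; ring.
  by rewrite HH KK d_eq; ring.
- rewrite w3 in d_eq *; split.
  + by rewrite PP HH d_eq; ring.
  + transitivity (c *+ 3 - d *+ 3 - c * c + d * d); first by ring.
    by rewrite scc sdd; ring.
  + transitivity (a *+ 3 - b *+ 3 - a * a + b * b); first by ring.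
    by rewrite saa sbb; ring.
  + transitivity (a * c + b * d - a * d - b * c); first by ring.
    by rewrite ac bd ad bc; ring.
Qed.

(** * Fourth powers of prime powers *)

(* An eigenvector [(z_oo = 1, zeta)] of the Paley conference matrix of order [q ^ 2 + 1] on the
   projective line over E, for the eigenvalue [lam = +-q], extends to a function on E * E
   whose sums over affine lines are again +-lam (lemma [line_ev_ext]). *)
Section Eigenvector.
Variable E : finFieldType.
Hypothesis E_odd : odd #|E|.
Local Notation V := (E * E)%type.
Variables (lam : int) (zeta : E -> int).
Hypothesis zeta_ev : forall w, 1 + \sum_t qchar (t - w) * zeta t = lam * zeta w.
Hypothesis zeta_sum : \sum_t zeta t = lam.

Definition ev_dir (l : option E) : int := if l is Some t then zeta t else 1.
(** The extension that is homogeneous with respect to the quadratic character and equals [ev_dir] on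
    direction vectors. *)
Definition ev_ext : galg V :=
  [ffun x => if x.1 == 0 then qchar x.2 else qchar x.1 * zeta (x.2 / x.1)].

Lemma ev_ext_scale a (x : V) : ev_ext (scale a x) = qchar a * ev_ext x.
Proof.
rewrite !ffunE /= mulf_eq0; have [->|a0] := eqVneq a 0.
  by rewrite /= mul0r qchar0 mul0r.
case: (x.1 == 0) => /=; first by rewrite qcharM.
by rewrite qcharM // -mulrA invfM mulrACA divff // mul1r.
Qed.

Lemma ev_ext_dir l : ev_ext (dir l) = ev_dir l.
Proof. by case: l => [t|]; rewrite ffunE /= ?eqxx ?oner_eq0 ?qchar1 ?divr1 ?mul1r. Qed.

Definition line_char l : galg V := [ffun x => qchar (slope_form l x)].

(** On the line of slope t through (0, d), d != 0, the substitution d / a turns the sum into the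
    eigenvector equation at t. Vertical lines off 0 use the sum of zeta, and on lines through 0 the
    character sums to 0. *)
Lemma line_ev_ext l : line l * ev_ext = line_char l *~ (lam * ev_dir l).
Proof.
apply/galgP => x; rewrite line_mulE gmulrzE ffunE.
have s0 := sum_qchar E_odd.
case: l => [t|] /=; last first.
  have [x0|x0] := eqVneq x.1 0.
    rewrite x0 qchar0 mul0r -[RHS]s0 [RHS](reindex_inj (subrI x.2)) /=.
    by apply: eq_bigr => a _; rewrite ffunE /= x0 mulr0 subr0 eqxx mulr1.
  rewrite mulr1 -[in RHS]zeta_sum big_distrr /=.
  rewrite [RHS](reindex_inj (_ : injective (fun a => (x.2 - a) / x.1))) /=.
    by apply: eq_bigr => a _; rewrite ffunE /= mulr0 subr0 (negPf x0) mulr1.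
  by move=> a b /(mulIf (invr_neq0 x0)) /subrI.
set d := x.2 - t * x.1.
transitivity (\sum_a ev_ext ((a, d + t * a) : V)).
  rewrite (reindex_inj (subrI x.1)) /=; apply: eq_bigr => a _.
  by rewrite /scale /= mulr1; congr (ev_ext (_, _)); rewrite /d /=; ring.
rewrite (bigD1 0) //= [ev_ext _]ffunE /= eqxx mulr0 addr0.
have [d0|d0] := eqVneq d 0.
  rewrite d0 qchar0 mul0r add0r (eq_bigr (fun a => qchar a * zeta t)) => [|a a0].
    by rewrite -big_distrl /=; move: s0; rewrite (bigD1 0) //= qchar0 add0r => ->; rewrite mul0r.
  by rewrite ffunE /= (negPf a0) add0r mulfK.
rewrite -zeta_ev mulrDr mulr1; congr (_ + _).
rewrite [in RHS](reindex_inj (addIr t)) [in RHS](bigD1 0) //= addrK qchar0 mul0r add0r.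
rewrite big_distrr /=.
rewrite (reindex_onto (fun a => d / a) (fun a => d / a)) => [|a a0]; last first.
  by rewrite invfM invrK mulrA divff // mul1r.
apply: eq_big => [a|a /andP[a0 _]].
  have [->|a0] := eqVneq a 0; first by rewrite invr0 mulr0 eqxx.
  by rewrite mulf_neq0 ?invr_neq0 // invfM invrK mulrA divff // mul1r eqxx.
have {}a0 : a != 0 by apply: contraNneq a0 => ->; rewrite invr0 mulr0.
rewrite ffunE /= mulf_eq0 (negPf d0) invr_eq0 (negPf a0) /= addrK qchar_div // -mulrA.
by congr (_ * (_ * zeta _)); field; rewrite a0 d0.
Qed.

End Eigenvector.

Section LineCharacters.
Variable E : finFieldType.
Hypothesis E_odd : odd #|E|.
Hypothesis E4 : (#|E| %% 4 = 1)%N.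
Local Notation V := (E * E)%type.

Lemma sum_slope_form (g : E -> int) l : \sum_(x : V) g (slope_form l x) = #|E|%:Z * \sum_t g t.
Proof.
rewrite -(pair_big predT predT (fun u v => g (slope_form l (u, v)))) /=.
case: l => [t|] /=.
  rewrite (eq_bigr (fun=> \sum_t g t)) => [|u _]; first by rewrite sumr_const -mulr_natl natz.
  by rewrite [RHS](reindex_inj (addIr (- (t * u)))).
rewrite big_distrr /=; apply: eq_bigr => u _.
by rewrite sumr_const -mulr_natl natz.
Qed.

(** Pulls back chi^2 = q - J along [slope_form l], whose fibres have q = |E| elements. *)
Lemma line_char_sq (l : option E) : line_char l * line_char l = (line l *+ #|E| - gone) *+ #|E|.
Proof.
apply/galgP => x; rewrite gmulE.
under eq_bigr => y _ do rewrite !ffunE slope_formB.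
rewrite (sum_slope_form (fun t => qchar t * qchar (slope_form l x - t))).
rewrite gmulrnE gaddE goppE goneallE gmulrnE ffunE.
have := congr1 (fun f : galg E => f (slope_form l x)) (gqchar_star E_odd).
rewrite gstar_even; last exact: gqchar_even.
rewrite gmulE gaddE goppE gnatE goneallE; under eq_bigr => t _ do rewrite !ffunE.
move=> ->; have mnE (a : int) n : a *+ n = n%:Z * a by rewrite -mulr_natl natz.
by rewrite !mnE; ring.
Qed.
End LineCharacters.

Section EigenvectorPair.
Variable E : finFieldType.
Hypothesis E8 : (#|E| %% 8 = 1)%N.
Local Notation V := (E * E)%type.
Variables (m : nat) (zeta1 zeta2 : E -> int).
Hypothesis m_sq : (m * m = #|E|)%N.
Hypothesis zeta1_pm1 : forall t, zeta1 t = 1 \/ zeta1 t = -1.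
Hypothesis zeta2_pm1 : forall t, zeta2 t = 1 \/ zeta2 t = -1.
Hypothesis zeta1_ev : forall w, 1 + \sum_t qchar (t - w) * zeta1 t = m%:Z * zeta1 w.
Hypothesis zeta2_ev : forall w, 1 + \sum_t qchar (t - w) * zeta2 t = - m%:Z * zeta2 w.
Hypothesis zeta1_sum : \sum_t zeta1 t = m%:Z.
Hypothesis zeta2_sum : \sum_t zeta2 t = - m%:Z.

Let E_odd : odd #|E|. Proof. by move: E8; move: #|E| => n; lia. Qed.
Let E4 : (#|E| %% 4 = 1)%N. Proof. by move: E8; move: #|E| => n; lia. Qed.

Let m_gt0 : (0 < m)%N.
Proof. by case: m m_sq => // /esym; have := card_finNzRing_gt1 E; rewrite mul0n => /[swap] ->. Qed.

Let z1 := ev_ext zeta1.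
Let z2 := ev_ext zeta2.
(** The directions where the eigenvectors agree: H = (z1 + z2)/2 lives on S and K = (z1 - z2)/2 off
    S. *)
Let S := [pred l | ev_dir zeta1 l == ev_dir zeta2 l].

Let H : galg V := [ffun x => if line_of x \in S then z1 x else 0].
Let K : galg V := [ffun x => if line_of x \in S then 0 else z1 x].

Let dir_pm1 (zeta : E -> int) l : (forall t, zeta t = 1 \/ zeta t = -1) ->
  ev_dir zeta l = 1 \/ ev_dir zeta l = -1.
Proof. by move=> zp; case: l => [t|] /=; [exact: zp | left]. Qed.

Let z_val (zeta : E -> int) (x : V) : exists a, ev_ext zeta x = qchar a * ev_dir zeta (line_of x) /\
  (x != 0 -> a != 0) /\ x = scale a (dir (line_of x)).
Proof.
have [a [e a0]] := line_of_scale x; exists a.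
by rewrite {1}e ev_ext_scale // ev_ext_dir.
Qed.

Let z1_pm1 (x : V) : x != 0 -> z1 x = 1 \/ z1 x = -1.
Proof.
have [a [-> [a0 _]]] := z_val zeta1 x => /a0 {}a0.
by apply: pm1M; [exact: qchar_pm1 | exact: dir_pm1].
Qed.

Let z0 (zeta : E -> int) : ev_ext zeta (0 : V) = 0.
Proof. by rewrite ffunE /= eqxx qchar0. Qed.

Let sumHK : z1 = H + K.
Proof.
by apply/galgP => x; rewrite gaddE [H x]ffunE [K x]ffunE; case: ifP; rewrite ?addr0 ?add0r.
Qed.

Let diffHK : z2 = H - K.
Proof.
apply/galgP => x; rewrite gaddE goppE [H x]ffunE [K x]ffunE /z1 /z2.
have [a [-> [_ e]]] := z_val zeta2 x.
have -> : ev_ext zeta1 x = qchar a * ev_dir zeta1 (line_of x).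
  by rewrite {1}e ev_ext_scale // ev_ext_dir.
rewrite inE; case: eqP => [->|ne]; first by rewrite subr0.
rewrite sub0r -mulrN; congr (_ * _); move: ne.
by case: (dir_pm1 (line_of x) zeta1_pm1) => ->; case: (dir_pm1 (line_of x) zeta2_pm1) => ->.
Qed.

Let w l := line_char l *~ ev_dir zeta1 l.

Let line_sum l : line l * H + line l * K = w l *+ m.
Proof.
by rewrite -mulrDr -sumHK (line_ev_ext E_odd zeta1_ev zeta1_sum) [m%:Z * _]mulrC mulrzA.
Qed.

Let line_diff l : line l * H - line l * K = (line_char l *~ ev_dir zeta2 l) *- m.
Proof.
by rewrite -mulrBr -diffHK (line_ev_ext E_odd zeta2_ev zeta2_sum) [- m%:Z * _]mulrC mulrzA mulrNz.
Qed.

(** The eigenvalues m and -m are opposite, so multiplying z1 + z2 by a line gives 0 exactly where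
    the eigenvectors agree. *)
Let line_H l : line l * H = if l \in S then 0 else w l *+ m.
Proof.
apply: (@gmulrnI _ 2) => //.
transitivity ((line l * H + line l * K) + (line l * H - line l * K)); first by ring.
rewrite line_sum line_diff /w inE; case: eqP => [->|ne]; first by rewrite subrr mul0rn.
have -> : ev_dir zeta2 l = - ev_dir zeta1 l.
  by move: ne; case: (dir_pm1 l zeta1_pm1) => ->; case: (dir_pm1 l zeta2_pm1) => ->.
by rewrite mulrNz mulNrn opprK -mulr2n.
Qed.

Let line_K l : line l * K = if l \in S then w l *+ m else 0.
Proof.
have := line_sum l; rewrite line_H; case: ifP => _; first by rewrite add0r.
by rewrite -[RHS]addr0 => /addrI.
Qed.

(** The lines through 0 add up to |E| + J, so the total of f can be read off at 0. *)
Let gone0 (f : galg V) : (forall l, (line l * f) 0 = 0) -> f 0 = 0 -> gone * f = 0.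
Proof.
move=> l0 f0; apply/galgP => x; rewrite mul_goneE gzeroE -(mul_goneE f 0).
have := congr1 (fun g : galg V => (g * f) 0) (pencil_all E).
rewrite mulrDl gaddE mulr_natl gmulrnE f0 mul0rn add0r => <-.
rewrite /pencil big_distrl gsumE big1 // => l _.
by rewrite mulr1z l0.
Qed.

Let w0 l : w l 0 = 0.
Proof.
rewrite gmulrzE ffunE (_ : slope_form l 0 = 0) ?qchar0 ?mul0r //.
by case: l => //= t; rewrite mulr0 subrr.
Qed.

Let H0 : H 0 = 0. Proof. by rewrite ffunE z0 if_same. Qed.
Let K0 : K 0 = 0. Proof. by rewrite ffunE z0 if_same. Qed.

Let goneH : gone * H = 0.
Proof.
by apply: gone0 => // l; rewrite line_H; case: ifP; rewrite ?gzeroE ?gmulrnE ?w0 ?mul0rn.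
Qed.

Let goneK : gone * K = 0.
Proof.
by apply: gone0 => // l; rewrite line_K; case: ifP; rewrite ?gzeroE ?gmulrnE ?w0 ?mul0rn.
Qed.

Let card_cancel (f g : galg V) : f *+ #|E| = g *+ #|E| -> f = g.
Proof. by apply: gmulrnI; rewrite -m_sq muln_gt0 m_gt0. Qed.

(** Plays the role of Fourier inversion, splitting f into parts invariant along each line. *)
Let expand (f : galg V) : gone * f = 0 -> f *+ #|E| = \sum_l line l * f.
Proof.
move=> gf; transitivity (pencil (fun=> 1) * f).
  by rewrite pencil_all mulrDl gf addr0 mulr_natl.
by rewrite /pencil big_distrl /=; apply: eq_bigr => l _; rewrite mulr1z.
Qed.

Let H_sum : H *+ m = \sum_(l | l \notin S) w l.
Proof.
apply: (gmulrnI m_gt0); rewrite -mulrnA m_sq expand // -sumrMnl [RHS]big_mkcond /=.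
by apply: eq_bigr => l _; rewrite line_H; case: (l \in S).
Qed.

Let K_sum : K *+ m = \sum_(l | l \in S) w l.
Proof.
apply: (gmulrnI m_gt0); rewrite -mulrnA m_sq expand // -sumrMnl [RHS]big_mkcond /=.
by apply: eq_bigr => l _; rewrite line_K; case: (l \in S).
Qed.

Let w_sq l : w l * w l = (line l *+ #|E| - gone) *+ #|E|.
Proof.
rewrite /w mulrzAl mulrzAr -mulrzA pm1_sq ?mulr1z ?line_char_sq //; exact: dir_pm1.
Qed.

Let mul2n (f g : galg V) : (f * g) *+ #|E| = (f *+ m) * (g *+ m).
Proof. by rewrite mulrnAl mulrnAr -mulrnA m_sq. Qed.

(** m w l is line l times an element annihilated by J, and two distinct lines multiply to J. *)
Let w_orth l l' : l != l' -> w l * w l' = 0.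
Proof.
move=> ll'; apply: card_cancel; rewrite mul0rn mul2n.
have wE k : exists2 f, w k *+ m = line k * f & gone * f = 0.
  have := (line_H k, line_K k).
  by case: (k \in S) => -[hH hK]; [exists K | exists H].
have [f -> gf] := wE l; have [g -> gg] := wE l'.
by rewrite mulrACA line_mul (negPf ll') mulrA gf mul0r.
Qed.

Let HK0 : H * K = 0.
Proof.
apply: card_cancel; rewrite mul0rn mul2n H_sum K_sum big_distrlr /=.
apply: big1 => l lS; apply: big1 => k kS; apply: w_orth.
by apply: contraNneq lS => ->.
Qed.

Let sq_sum (A : {pred option E}) :
  (\sum_(l | l \in A) w l) * (\sum_(l | l \in A) w l) =
  (pencil (fun l => (l \in A)%:Z) *+ #|E| - gone *+ #|A|) *+ #|E|.
Proof.
rewrite big_distrlr /=.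
transitivity (\sum_(l | l \in A) (line l *+ #|E| - gone) *+ #|E|).
  apply: eq_bigr => l lA; rewrite (bigD1 l) //= w_sq big1 ?addr0 // => k /andP[_ kl].
  by apply: w_orth; rewrite eq_sym.
rewrite sumrMnl sumrB sumrMnl sumr_const; congr ((_ *+ _ - _) *+ _).
rewrite big_mkcond /=; apply: eq_bigr => l _.
by case: (l \in A).
Qed.

Let HH : H * H = pencil (fun l => (l \notin S)%:Z) *+ #|E| - gone *+ #|[predC S]|.
Proof.
apply: card_cancel; rewrite mul2n H_sum -sq_sum; congr (_ * _); exact: eq_bigl.
Qed.

Let KK : K * K = pencil (fun l => (l \in S)%:Z) *+ #|E| - gone *+ #|S|.
Proof. by apply: card_cancel; rewrite mul2n K_sum -sq_sum. Qed.

Let HHKK : H * H + K * K = #|{: V}|%:R - gone.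
Proof.
rewrite HH KK addrACA -mulrnDl -opprD -mulrnDr [(#|[predC S]| + _)%N]addnC cardC card_option.
have -> : pencil (fun l => (l \notin S)%:Z) + pencil (fun l => (l \in S)%:Z) =
    pencil (fun=> 1 : int).
  rewrite /pencil -big_split; apply: eq_bigr => l _ /=.
  by rewrite -mulrzDr; case: (l \in S).
by rewrite pencil_all card_prod natrM mulrS mulrnDl -mulr_natr; ring.
Qed.

Let z1N (x : V) : z1 (- x) = z1 x /\ line_of (- x) = line_of x.
Proof.
have xN : - x = scale (-1) x by case: x => u v; congr pair; rewrite /= mulN1r.
split; first by rewrite xN /z1 ev_ext_scale // qcharN1 // mul1r.
by rewrite /line_of /= oppr_eq0 invrN mulrNN.
Qed.

Let H_even : geven H.
Proof. by move=> x; have [zN lN] := z1N x; rewrite [LHS]ffunE [RHS]ffunE lN zN. Qed.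

Let K_even : geven K.
Proof. by move=> x; have [zN lN] := z1N x; rewrite [LHS]ffunE [RHS]ffunE lN zN. Qed.

(* Both sides of [HH] at 0: [H * H] counts the support of H. *)
Let card_S : #|S| = #|[predC S]|.
Proof.
have cS (A : {pred option E}) : \sum_l (l \in A)%:Z = #|A|%:Z.
  transitivity (\sum_(l in A) 1 : int); last by rewrite sumr_const natz.
  by rewrite [RHS]big_mkcond; apply: eq_bigr => l _; case: (l \in A).
have : (H * H) 0 = #|S|%:Z * (#|E|%:Z - 1).
  transitivity (gaug (pencil (fun l => (l \in S)%:Z) - #|S|%:R : galg V)); last first.
    by rewrite rmorphB /= gaug_pencil rmorph_nat natz cS mulrBr mulr1.
  rewrite gmulE; apply: eq_bigr => y _; rewrite sub0r H_even gaddE goppE gnatE pencilE ffunE.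
  have [->|y0] := eqVneq y 0; first by rewrite /z1 z0 if_same mul0r mulr1 cS subrr.
  rewrite mulr0 subr0; case: ifP => _; last by rewrite mul0r.
  by rewrite pm1_sq //; exact: z1_pm1.
have -> : (H * H) 0 = #|[predC S]|%:Z * (#|E|%:Z - 1).
  rewrite HH gaddE goppE !gmulrnE goneallE pencilE eqxx (cS [predC S]) mulrBr mulr1.
  by rewrite natz -[X in X - _]mulr_natr natz.
have e : #|E|%:Z - 1 != 0.
  by rewrite subr_eq0 eqz_nat neq_ltn; have := card_finNzRing_gt1 E => ->; rewrite orbT.
by move=> /(mulIf e)/eqP; rewrite eqz_nat => /eqP.
Qed.

(** Lines outside S annihilate K and carry P; lines in S annihilate H and carry R. The formulas for
    P^2 and H^2 differ by J. *)
Lemma orthogonal_quadruple_ev : exists P R H K : galg V, orthogonal_quadruple P R H K.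
Proof.
have oS : odd #|S|.
  have := cardC S; rewrite card_option -card_S addnn => /(congr1 half); rewrite doubleK => ->.
  by move: E8; move: #|E| => n; lia.
have [|||||||||e [f [Q e0 f0 PP _]]] := @pencil_quadruple E S H K.
- exact: oS.
- by rewrite -card_S.
- exact: H_even.
- exact: K_even.
- exact: H0.
- exact: K0.
- by move=> x x0 lS; rewrite [H x]ffunE [K x]ffunE lS; split=> //; exact: z1_pm1.
- by move=> x x0 lS; rewrite [H x]ffunE [K x]ffunE (negPf lS); split=> //; exact: z1_pm1.
- exact: HHKK.
exists (pencil e), (pencil f), H, K; split=> //; split.
- rewrite PP HH -addrA; congr (_ + _); rewrite mulrzBr mulr1z -pmulrn addrC; by [].
- rewrite /pencil big_distrl /= big1 // => l _; rewrite mulrzAl line_K.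
  by case: (boolP (l \in S)) => [/e0->|_]; rewrite ?mulr0z ?mul0rz.
- rewrite /pencil big_distrl /= big1 // => l _; rewrite mulrzAl line_H.
  by case: (boolP (l \in S)) => [_|/f0->]; rewrite ?mulr0z ?mul0rz.
- exact: HK0.
Qed.
End EigenvectorPair.

(** * Eigenvectors of the Paley matrix over a quadratic extension *)

Section QuadraticEigenvector.
Variables (F : finFieldType) (d : {n : F | [forall b, b * b != n]}).
Hypothesis F_odd : odd #|F|.
Local Notation E := (quad_ext d).
Local Notation q := #|F|.
Let E_odd : odd #|{: E}|. Proof. exact: odd_quad_ext. Qed.

Lemma sum_quad_ext (g : E -> int) : \sum_(t : E) g t = \sum_v \sum_u g ((u, v) : E).
Proof. by rewrite exchange_big pair_bigA; apply: eq_bigr => -[u v]. Qed.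

Let fiber v : int := \sum_(u : F) qchar ((u, v) : E).

Let predq : q.-1%:Z = q%:Z - 1.
Proof.
have q0 : (0 < q)%N by apply/card_gt0P; exists 0.
by rewrite -[in RHS](prednK q0) -addn1 PoszD addrK.
Qed.

Let fiber0 : fiber 0 = q%:Z - 1.
Proof.
rewrite /fiber (bigD1 0) //= [qchar _]qchar0 add0r.
rewrite (eq_bigr (fun=> 1)) => [|u u0]; last exact: (qchar_quad_of d F_odd u0).
rewrite sumr_const natz (_ : #|_| = q.-1); last by rewrite -(cardC1 (0 : F)).
exact: predq.
Qed.

Let fiber_scale v : v != 0 -> fiber v = fiber 1.
Proof.
move=> v0; rewrite /fiber (reindex_inj (mulfI v0)); apply: eq_bigr => u _ /=.
have -> : ((v * u, v) : E) = quad_of d v * ((u, 1) : E).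
  by rewrite quad_of_mul /scale /= mulr1.
by rewrite qcharM // qchar_quad_of // mul1r.
Qed.

(** Nonzero elements of fibre 0 are squares, the other fibres have equal sums by scaling, and the
    total is 0. *)
Let fiberE v : fiber v = q%:Z * (v == 0)%:Z - 1.
Proof.
have [->|v0] := eqVneq v 0; first by rewrite mulr1 fiber0.
rewrite mulr0 sub0r fiber_scale //.
have := sum_qchar E_odd; rewrite sum_quad_ext (bigD1 0) //= -/(fiber 0) fiber0.
rewrite (eq_bigr (fun=> fiber 1)) => [|u u0]; last exact: fiber_scale.
rewrite sumr_const (_ : #|_| = q.-1); last by rewrite -(cardC1 (0 : F)).
have q1 := card_finNzRing_gt1 F.
rewrite -mulr_natr natz predq -[X in X + _]mul1r -mulrDl => /eqP; rewrite mulf_eq0 => /orP[|].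
  by rewrite addrC addr_eq0 => /eqP.
by rewrite subr_eq0 eqz_nat => /eqP e; rewrite e in q1.
Qed.

Variable e : F -> int.
Hypothesis e_sum : \sum_v e v = 1.

(** The vector depends on the second coordinate only, so fibre sums q delta - 1 appear; as e sums to
    1, the constants cancel. *)
Lemma quad_eigenvector (w : E) :
  1 + \sum_(t : E) qchar (t - w) * e t.2 = q%:Z * e w.2.
Proof.
rewrite sum_quad_ext.
transitivity (1 + \sum_v fiber (v - w.2) * e v).
  congr (_ + _); apply: eq_bigr => v _.
  by rewrite /fiber mulr_suml [RHS](reindex_inj (addIr (- w.1))); apply: eq_bigr => u _; case: w.
under eq_bigr => v _ do rewrite fiberE subr_eq0 mulrBl mul1r.
rewrite sumrB e_sum addrC subrK (bigD1 w.2) //= eqxx mulr1 big1 ?addr0 // => v /negPf ->.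
by rewrite mulr0 mul0r.
Qed.

Lemma quad_eigenvector_sum : \sum_(t : E) e t.2 = q%:Z.
Proof.
rewrite sum_quad_ext; under eq_bigr => v _ do rewrite /= sumr_const -mulr_natr natz.
by rewrite -big_distrl /= e_sum mul1r.
Qed.
End QuadraticEigenvector.

Theorem orthogonal_quadruple_pow4 (F : finFieldType) : odd #|F| ->
  exists (G : finZmodType) (P R H K : galg G),
  #|G| = (#|F| ^ 4)%N /\ orthogonal_quadruple P R H K.
Proof.
move=> F_odd; have [n nP] := quad_ext_ex F_odd.
pose d := exist _ n nP : {n : F | [forall b, b * b != n]}.
pose E : finFieldType := quad_ext d.
have cE : #|E| = (#|F| ^ 2)%N by exact: card_quad_ext.
have E_odd : odd #|E| by exact: odd_quad_ext.
have E8 : (#|E| %% 8 = 1)%N.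
  rewrite cE; have := F_odd; set q := #|F|.
  rewrite (divn_eq q 8) => oq.
  have : (q %% 8 < 8)%N by rewrite ltn_mod.
  rewrite -modnXm modnMDl modn_mod; move: oq; rewrite oddD oddM andbF /=.
  by case: (q %% 8)%N => [|[|[|[|[|[|[|[|]]]]]]]].
have [e [e1 _ es]] := @sign_sum1 F predT F_odd.
have {}e1 v : e v = 1 \/ e v = -1 by exact: e1.
have [tau t1] := nonresidue_ex E_odd; have tau0 := nonresidue_neq0 E_odd t1.
(* Dilation by the nonresidue tau negates the character and hence the eigenvalue; the minus sign
   keeps the coordinate 1 at infinity. *)
pose zeta1 (t : E) : int := e t.2; pose zeta2 (t : E) : int := - zeta1 (t / tau).
have [|||||||P [R [H [K Q]]]] := @orthogonal_quadruple_ev E E8 #|F| zeta1 zeta2.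
- by rewrite cE mulnn.
- by move=> t; exact: e1.
- by move=> t; apply: pm1N; exact: e1.
- by move=> w; exact: (@quad_eigenvector F d F_odd e es w).
- move=> w; rewrite /zeta2 (reindex_inj (mulIf tau0)) /=.
  transitivity (1 + \sum_(t : E) qchar (t - w / tau) * zeta1 t).
    congr (_ + _); apply: eq_bigr => t _; rewrite mulfK // -{1}[w](divfK tau0) -mulrBl.
    by rewrite qcharM // (qchar_nonresidue E_odd t1) mulrN1 mulrNN.
  by rewrite (@quad_eigenvector F d F_odd e es (w / tau)) mulrNN.
- exact: (@quad_eigenvector_sum F d e es).
- rewrite /zeta2 sumrN -[in RHS](@quad_eigenvector_sum F d e es); congr (- _).
  by rewrite (reindex_inj (mulIf tau0)); apply: eq_bigr => t _; rewrite mulfK.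
exists (E * E)%type, P, R, H, K; split=> //.
by rewrite card_prod cE -expnD.
Qed.

(** * The orders of the theorem *)

Definition quadruple_order (v : nat) : Prop :=
  exists (G : finZmodType) (P R H K c : galg G),
  [/\ #|G| = v, quadruple P R H K & conference_core c].

(** Splits off one prime factor at a time, composing with the quadruple of order p^4; the trivial
    group starts the induction. *)
Lemma orthogonal_order_pow4 n : odd n ->
  exists (G : finZmodType) (P R H K : galg G), #|G| = (n ^ 4)%N /\ orthogonal_quadruple P R H K.
Proof.
elim/ltn_ind: n => n IH on.
have [n1|n1] := leqP n 1.
  have -> : n = 1%N by case: n on n1 {IH} => [|[]].
  have [P [R [H [K Q]]]] := orthogonal_quadruple_one.
  by exists 'I_1, P, R, H, K; rewrite card_ord exp1n.
have pp := pdiv_prime n1; set p := pdiv n in pp.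
have [m nE] := dvdnP (pdiv_dvd n); rewrite -/p in nE.
have /andP[om op] : odd m && odd p by rewrite -oddM -nE.
have m_lt : (m < n)%N.
  rewrite nE ltn_Pmulr ?prime_gt1 //; case: m nE om {IH} => //.
have [G1 [P [R [H [K [c1 Q1]]]]]] := IH m m_lt om.
have oF : odd #|'F_p| by rewrite card_Fp.
have [G2 [p' [r [h [k [c2 Q2]]]]]] := orthogonal_quadruple_pow4 oF.
have [P' [R' [H' [K' Q]]]] := orthogonal_product Q1 Q2.
exists (G1 * G2)%type, P', R', H', K'; split=> //.
by rewrite card_prod c1 c2 card_Fp // nE expnMn.
Qed.

Lemma Phi1_order v : Phi1 v -> quadruple_order v.
Proof.
move=> [q [[p [k [pp k0 qE]]] q4 ->]].
have [F _ cF] := pPrimePowerField pp k0.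
have F4 : (#|F| %% 4 = 1)%N by rewrite cF -qE q4.
by have := quadruple_prime_power_sq F4; rewrite cF -qE.
Qed.

Lemma Phi2_order v : Phi2 v -> quadruple_order v.
Proof.
move=> [n [n2 vE]]; have on : odd n by move: n2; rewrite !modn2; case: (odd n).
have [G [P [R [H [K [cG Q]]]]]] := orthogonal_order_pow4 on.
case: vE => ->.
  by exists G, P, R, H, K, (H + K); split=> //; [case: Q | exact: orthogonal_core Q].
have [p [r [h [k Q9]]]] := orthogonal_quadruple_nine.
have [P' [R' [H' [K' Q']]]] := orthogonal_product Q9 Q.
exists (('F_3 * 'F_3) * G)%type, P', R', H', K', (H' + K').
split; [|by case: Q' | exact: orthogonal_core Q'].
by rewrite !card_prod cG card_Fp.
Qed.

Lemma paley1_order p : prime p -> (p %% 4 = 3)%N ->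
  exists M : 'M[int]_(p + 1), hadamard_matrix M.
Proof.
move=> pp p4; have cF := card_Fp pp.
by have := @paley1 'F_p; rewrite cF mul1n; apply.
Qed.

Lemma paley2_order p : prime p -> (p %% 4 = 1)%N ->
  exists M : 'M[int]_(2 * (p + 1)), hadamard_matrix M.
Proof.
by move=> pp p4; have cF := card_Fp pp; have := @paley2 'F_p; rewrite cF; apply.
Qed.

Lemma hadamard_pow2 k : exists M : 'M[int]_(2 ^ k), hadamard_matrix M.
Proof.
elim: k => [|k IH]; last by rewrite expnS; exact: hadamard_double.
apply: (@hadamard_on_matrix unit (fun _ _ => 1)); first by rewrite card_unit.
split=> [_ _|[] []]; first by left.
by rewrite sumr_const card_unit.
Qed.

Theorem theorem1p9 :
  [/\ forall v : nat, [\/ Phi1 v, Phi2 v, Phi3 v | Phi4 v] ->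
        exists M : 'M[int]_(4 * (2 * v + 1)), hadamard_matrix M,
      forall v : nat, [\/ Phi1 v, Phi2 v | Phi3 v] ->
        exists M : 'M[int]_(4 * (3 * v + 1)), hadamard_matrix M,
      forall v : nat, [\/ Phi1 v, Phi2 v | Phi3 v] ->
        exists M : 'M[int]_(4 * (5 * v + 1)), hadamard_matrix M
    & forall u v : nat, Phi1 u \/ Phi2 u -> [\/ Phi1 v, Phi2 v | Phi3 v] ->
        exists M : 'M[int]_(8 * (u * v + 1)), hadamard_matrix M].
Proof.
have part3 v : quadruple_order v -> exists M : 'M[int]_(4 * (5 * v + 1)), hadamard_matrix M.
  by move=> [G [P [R [H [K [c [<- Q C]]]]]]]; exact: hadamard_5v Q C.
split.
- move=> v vP; have [|] : quadruple_order v \/ (Phi3 v \/ Phi4 v).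
    by case: vP => [/Phi1_order|/Phi2_order||]; [left|left|right; left|right; right].
    by move=> [G [P [R [H [K [c [<- Q C]]]]]]]; exact: hadamard_2v Q C.
  (* The orders are 44 = 43 + 1, 108 = 107 + 1 and 300 = 2 (149 + 1). *)
  case=> [->|[|] ->]; [exact: (@paley1_order 43) | exact: (@paley1_order 107)
    | exact: (@paley2_order 149)].
(* For v = 5 the order is 64 = 2^6. *)
- move=> v; case=> [/Phi1_order|/Phi2_order|->]; last exact: (hadamard_pow2 6).
    by move=> [G [P [R [H [K [c [<- Q C]]]]]]]; exact: hadamard_3v Q C.
  by move=> [G [P [R [H [K [c [<- Q C]]]]]]]; exact: hadamard_3v Q C.
- move=> v; case=> [/Phi1_order|/Phi2_order|->]; [exact: part3 | exact: part3 |].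
  exact: (@paley1_order 103).
- move=> u v uP vP; have {}uP : quadruple_order u by case: uP => [/Phi1_order|/Phi2_order].
  have [vQ|->] : quadruple_order v \/ v = 5.
    by case: vP => [/Phi1_order|/Phi2_order|]; [left|left|right].
    have [G1 [P [R [H [K [c [<- Q1 C1]]]]]]] := uP.
    have [G2 [p [r [h [k [c' [<- Q2 C2]]]]]]] := vQ.
    exact: hadamard_uv Q1 Q2.
  have -> : (8 * (u * 5 + 1) = 2 * (4 * (5 * u + 1)))%N by lia.
  by apply: hadamard_double; exact: part3.
Qed.
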